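(* Let $K$ be a field of characteristic $p > 0$ and let $G$ be a finitely generated subgroup of $K^\ast \times K^\ast$ of rank $r$. Then the equation $$x + y = 1 \quad \text{in } (x,y) \in G$$ has at most $31 \cdot 19^{r}$ solutions $(x,y)$ satisfying $(x,y) \notin G^p$.
   Context: The group $K^\ast \times K^\ast$ carries coordinatewise multiplication. The rank of $G$ is $\dim_{\mathbb{Q}} (G \otimes_{\mathbb{Z}} \mathbb{Q})$, and $G^p := \{g^p : g \in G\}$. *)

(* Defs.v *)
From HB Require Import structures.
From mathcomp Require Import all_boot all_order all_algebra.
From mathcomp Require Import all_classical.

Set Implicit Arguments.
Unset Strict Implicit.
Unset Printing Implicit Defensive.

Import GRing.Theory.
Local Open Scope classical_set_scope.
Local Open Scope ring_scope.

(* The multiplicative group K^*; MathComp's {unit R} requires R to be finite. *)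
Record mulgrp (K : fieldType) := MulGrp {
  mulgrp_val : K; mulgrp_valP : mulgrp_val != 0 }.

Section MulGroup.
Variable K : fieldType.

HB.instance Definition _ := [isSub for @mulgrp_val K].
HB.instance Definition _ := [Choice of mulgrp K by <:].

Implicit Types x y z : mulgrp K.

Definition mulgrp_one : mulgrp K := MulGrp (oner_neq0 K).

Lemma mulgrp_mul_subproof x y : val x * val y != 0.
Proof. by rewrite mulf_neq0 ?mulgrp_valP. Qed.
Definition mulgrp_mul x y : mulgrp K := MulGrp (mulgrp_mul_subproof x y).

Lemma mulgrp_inv_subproof x : (val x)^-1 != 0.
Proof. by rewrite invr_eq0 mulgrp_valP. Qed.
Definition mulgrp_inv x : mulgrp K := MulGrp (mulgrp_inv_subproof x).

Lemma mulgrp_mulA : associative mulgrp_mul.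
Proof. by move=> x y z; apply: val_inj; rewrite /= mulrA. Qed.
Lemma mulgrp_mul1 : left_id mulgrp_one mulgrp_mul.
Proof. by move=> x; apply: val_inj; rewrite /= mul1r. Qed.
Lemma mulgrp_mulr1 : right_id mulgrp_one mulgrp_mul.
Proof. by move=> x; apply: val_inj; rewrite /= mulr1. Qed.
Lemma mulgrp_mulV : left_inverse mulgrp_one mulgrp_inv mulgrp_mul.
Proof. by move=> x; apply: val_inj; rewrite /= mulVf ?mulgrp_valP. Qed.
Lemma mulgrp_mulrV : right_inverse mulgrp_one mulgrp_inv mulgrp_mul.
Proof. by move=> x; apply: val_inj; rewrite /= mulfV ?mulgrp_valP. Qed.

HB.instance Definition _ := isGroup.Build (mulgrp K)
  mulgrp_mulA mulgrp_mul1 mulgrp_mulr1 mulgrp_mulV mulgrp_mulrV.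

End MulGroup.

Definition subgroup (gT : groupType) (G : set gT) : Prop :=
  group_closed (mem G).

Definition finitely_generated (gT : groupType) (G : set gT) : Prop :=
  exists2 S : set gT, finite_set S & G = smallest (@subgroup gT) S.

(* Z-bilinear maps G x Q -> W, with the group G written multiplicatively;
   values of b outside G are irrelevant. *)
Definition biadditive_on (gT : groupType) (G : set gT) (W : zmodType)
    (b : gT -> rat -> W) : Prop :=
  (forall g h q, G g -> G h -> b (g * h)%g q = b g q + b h q) /\
  (forall g q q', G g -> b g (q + q') = b g q + b g q').

(* The Q-vector space V, together with t g q = g (x) q, is the tensor product of
   G and Q over Z, given by its universal property. *)
Definition is_tensor_rat (gT : groupType) (G : set gT) (V : vectType rat)
    (t : gT -> rat -> V) : Prop :=
  [/\ biadditive_on G t,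
      forall g a q, G g -> t g (a * q) = a *: t g q
    & forall (W : zmodType) (b : gT -> rat -> W), biadditive_on G b ->
        exists2 f : {additive V -> W},
          forall g q, G g -> f (t g q) = b g q
        & forall f' : {additive V -> W},
            (forall g q, G g -> f' (t g q) = b g q) -> f' =1 f].

(* dim_Q (G (x)_Z Q) = r; the universal property determines the tensor product,
   hence r, uniquely. *)
Definition has_rank (gT : groupType) (G : set gT) (r : nat) : Prop :=
  exists (V : vectType rat) (t : gT -> rat -> V),
    is_tensor_rat G t /\ \dim {:V} = r.

(* Main.v *)
(* For the solutions under consideration x is transcendental over F_p, since an
   algebraic x is fixed by a power of Frobenius and then (x, 1 - x) is a p-th
   power in G.  Let t be such an x and let E be a subfield of K maximal among
   those over which t is transcendental, so that any two elements of K are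
   algebraically dependent over E.  If A is the monoid generated by the
   coordinates of G and their inverses, then h(z), the rank of A over E(z) (and 0
   if z is algebraic over E), behaves as the degree of z viewed as a function on a
   curve over E: it is subadditive on A, invariant under z -> 1/z and z -> 1 - z,
   and h(z^n) >= n h(z).  Summing h over finitely many solutions makes it positive
   at each of them, and N(a, b) = h(a) + h(b) + h(a/b) is a seminorm on G (x) Q
   with N = 3 h(x) at a solution (x, 1 - x).

   Let u = (x, 1 - x) and v = (y, 1 - y) be distinct solutions with
   N(u) <= N(v) < p N(u).  Polynomials a, b, c over F_p of degree at most k with
   a X^m + b (1 - X)^m + c = 0, m = 2k + 1, give a linear relation between x^m,
   (1 - x)^m and 1 with coefficients of small degree in x; comparing it with
   z1 x^m + z2 (1 - x)^m = 1, where (z1, z2) = v u^(-m), bounds k h(x) by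
   h(z1) + h(z2), unless both relations are proportional and y is a rational
   function of x^p.  Symmetrizing, k N(u) <= 2 N(v u^(-m)): solutions of
   comparable size repel each other, and also repel odd powers.

   Projectively, after rescaling by N, a family of points of an r-dimensional
   normed space at mutual distance more than 1/9 has at most 19^r members.  The
   solutions close to one of them can be moved by Frobenius into a common window
   [H, p H), where the repulsion forces their sizes to grow at least by the factor
   27/22 at each step while staying within a factor 54 of each other: there are at
   most 24 of them. *)
Require Import Defs.
From HB Require Import structures.
From mathcomp Require Import all_boot all_order all_algebra.
From mathcomp Require Import all_classical.
From mathcomp Require Import ring lra zify.

Set Implicit Arguments.
Unset Strict Implicit.
Unset Printing Implicit Defensive.
Import GRing.Theory Order.TTheory Num.Theory.
Local Open Scope ring_scope.

(** * Polynomial relations between two elements *)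

Lemma lin_dep (E : fieldType) (I J : finType) (phi : I -> J -> E) :
  (#|J| < #|I|)%N ->
  exists2 e : I -> E, exists i, e i != 0 & forall j, \sum_i e i * phi i j = 0.
Proof.
move=> ltJI; pose M := \matrix_(i < #|I|, j < #|J|) phi (enum_val i) (enum_val j).
have : kermx M != 0.
  by rewrite -mxrank_eq0 mxrank_ker subn_eq0 -ltnNge (leq_ltn_trans (rank_leq_col M)).
case/rowV0Pn=> v /sub_kermxP vM0 /rV0Pn[i vi].
exists (fun i => v 0 (enum_rank i)) => [|j].
  by exists (enum_val i); rewrite enum_valK.
have /matrixP/(_ 0 (enum_rank j)) := vM0; rewrite !mxE => vM0j; rewrite -[RHS]vM0j.
rewrite [RHS](reindex (@enum_rank I)) /=; last exact/onW_bij/enum_rank_bij.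
by apply: eq_bigr => k _; rewrite mxE !enum_rankK.
Qed.

(** The [v i] live in the space of [d]-tuples of polynomials supported in an [al] by [be] box, of
    dimension [d * (al * be)] over E. *)
Lemma bipoly_dep (E : fieldType) (I : finType) (d al be : nat)
    (v : I -> 'I_d -> {poly {poly E}}) :
  (forall i k, size (v i k) <= be)%N -> (forall i k, sizeY (v i k) <= al)%N ->
  (d * (al * be) < #|I|)%N ->
  exists2 e : I -> E, exists i, e i != 0
    & forall k, \sum_i (e i)%:P%:P * v i k = 0.
Proof.
move=> szv szYv ltI.
pose phi i (j : 'I_d * ('I_al * 'I_be)) := (v i j.1)`_(j.2.2)`_(j.2.1).
have [|e e_nz e0] := @lin_dep E I _ phi.
  by rewrite !card_prod !card_ord.
exists e => // k; apply/polyP=> j; apply/polyP=> i; rewrite coef0 coef0 !coef_sum.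
have [ltj|gej] := ltnP j be; last first.
  rewrite big1 // => h _.
  by rewrite mul_polyC coefZ (nth_default _ (leq_trans (szv _ _) gej)) mulr0 coef0.
have [lti|gei] := ltnP i al; last first.
  rewrite big1 // => h _.
  rewrite !mul_polyC !coefZ mul_polyC coefZ nth_default ?mulr0 //.
  exact: leq_trans (max_size_coefXY _ _) (leq_trans (szYv _ _) gei).
rewrite -[RHS](e0 (k, (Ordinal lti, Ordinal ltj))).
by apply: eq_bigr => h _; rewrite mul_polyC coefZ mul_polyC coefZ.
Qed.

Lemma irreducible_dvdp (E : fieldType) (c : {poly E}) :
  (1 < size c)%N -> exists2 q, irreducible_poly q & q %| c.
Proof.
move=> sc; pose P n := `[< exists2 q : {poly E}, size q = n & (1 < n)%N /\ q %| c >].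
have exP : exists n, P n by exists (size c); apply/asboolP; exists c.
have [n /asboolP[q sq [n_gt1 qc]] minn] := ex_minnP exP.
exists q => //; split=> [|q' sq' q'q]; first by rewrite sq.
have q'0 : q' != 0.
  by apply: contraTneq q'q => ->; rewrite dvd0p -size_poly_eq0 sq -lt0n ltnW.
rewrite -dvdp_size_eqp // eqn_leq dvdp_leq ?sq //=; last by rewrite -size_poly_eq0 sq -lt0n ltnW.
apply: minn; apply/asboolP; exists q' => //; split; last exact: dvdp_trans qc.
by move: q'0 sq'; rewrite -size_poly_eq0; case: (size q') => [|[|]].
Qed.

(** If [i] and [j] are the first indices where [pi] fails to divide the coefficients of [f] and of
    [g], then modulo [pi] coefficient [i + j] of [f * g] is the product of these two
    coefficients. *)
Lemma gauss_irreducible (E : fieldType) (pi : {poly E}) (f g : {poly {poly E}}) :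
  irreducible_poly pi -> (forall i, pi %| (f * g)`_i) ->
  (forall i, pi %| f`_i) \/ (forall i, pi %| g`_i).
Proof.
move=> irr fgP; apply: contrapT => /not_orP[/existsNP exf /existsNP exg].
have {}exf : exists i, ~~ (pi %| f`_i) by case: exf => i /negP; exists i.
have {}exg : exists i, ~~ (pi %| g`_i) by case: exg => i /negP; exists i.
have [i fi minf] := ex_minnP exf; have [j gj ming] := ex_minnP exg.
have := fgP (i + j)%N; rewrite coefM.
have lti : (i < (i + j).+1)%N by rewrite ltnS leq_addr.
rewrite (bigD1 (Ordinal lti)) //= addKn dvdp_addl.
  by rewrite Gauss_dvdpr ?(negPf gj) // irreducible_poly_coprime.
apply: (big_ind (fun u => pi %| u)) => [|u v|k nki]; rewrite ?dvdp0 //; first exact: dvdp_add.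
have [ltk|gek] := ltnP k i.
  rewrite dvdp_mulr //; apply: contraTT ltk => /minf; by rewrite -leqNgt.
rewrite dvdp_mull //; apply: contraTT (gek) => /ming lej; rewrite -ltnNge.
by move: nki (ltn_ord k) lej gek; rewrite -val_eqE /=; lia.
Qed.

Lemma polyC_dvd (E : fieldType) (pi : {poly E}) (f : {poly {poly E}}) :
  (forall i, pi %| f`_i) -> exists f', f = pi *: f'.
Proof.
move=> fP; exists (\poly_(i < size f) (f`_i %/ pi)).
apply/polyP=> i; rewrite coefZ coef_poly; case: ltnP => [_|/(nth_default _) ->].
  by rewrite mulrC divpK.
by rewrite mulr0.
Qed.

Lemma sizeYM (E : fieldType) (f g : {poly {poly E}}) :
  f != 0 -> g != 0 -> sizeY (f * g) = (sizeY f + sizeY g).-1.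
Proof. by move=> f0 g0; rewrite !sizeYE rmorphM size_mul ?swapXY_eq0. Qed.

(** * Evaluation of polynomials and minimal relations *)

Section Eval.
Variables (E K : fieldType) (iota : {rmorphism E -> K}).

Definition ev (x : K) : {poly E} -> K :=
  horner_morph (fun a => mulrC x (iota a)).
HB.instance Definition _ x := GRing.RMorphism.copy (ev x)
  (horner_morph (fun a => mulrC x (iota a))).
(** The inner variable goes to [x] and the outer one to [z]: [size] measures the degree in [z], and
    [sizeY] the degree in [x]. *)
Definition ev2 (x z : K) : {poly {poly E}} -> K :=
  horner_morph (fun a => mulrC z (ev x a)).
HB.instance Definition _ x z := GRing.RMorphism.copy (ev2 x z)
  (horner_morph (fun a => mulrC z (ev x a))).

Lemma evC x a : ev x a%:P = iota a. Proof. exact: horner_morphC. Qed.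
Lemma evX x : ev x 'X = x. Proof. exact: horner_morphX. Qed.
Lemma ev2C x z a : ev2 x z a%:P = ev x a. Proof. exact: horner_morphC. Qed.
Lemma ev2X x z : ev2 x z 'X = z. Proof. exact: horner_morphX. Qed.

Lemma ev2M x z f g : ev2 x z (f * g) = ev2 x z f * ev2 x z g.
Proof. exact: rmorphM. Qed.
Lemma evM x p q : ev x (p * q) = ev x p * ev x q. Proof. exact: rmorphM. Qed.
Lemma evB x p q : ev x (p - q) = ev x p - ev x q. Proof. exact: rmorphB. Qed.
Lemma evN x p : ev x (- p) = - ev x p. Proof. exact: rmorphN. Qed.
Lemma ev0 x : ev x 0 = 0. Proof. exact: rmorph0. Qed.
Lemma ev1 x : ev x 1 = 1. Proof. exact: rmorph1. Qed.
Lemma evXn x p n : ev x (p ^+ n) = ev x p ^+ n. Proof. exact: rmorphXn. Qed.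
Lemma ev2D x z f g : ev2 x z (f + g) = ev2 x z f + ev2 x z g.
Proof. exact: rmorphD. Qed.
Lemma ev2_1 x z : ev2 x z 1 = 1. Proof. exact: rmorph1. Qed.
Lemma ev2B x z f g : ev2 x z (f - g) = ev2 x z f - ev2 x z g.
Proof. exact: rmorphB. Qed.
Lemma ev2N x z f : ev2 x z (- f) = - ev2 x z f. Proof. exact: rmorphN. Qed.

Lemma ev_sum x n (c : {poly E}) : (size c <= n)%N -> ev x c = \sum_(i < n) iota c`_i * x ^+ i.
Proof.
move=> sz; rewrite /ev /horner_morph (@horner_coef_wide _ n) ?size_map_poly //.
by apply: eq_bigr => i _; rewrite coef_map.
Qed.

Lemma ev2_sum x z n (c : {poly {poly E}}) :
  (size c <= n)%N -> ev2 x z c = \sum_(i < n) ev x c`_i * z ^+ i.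
Proof.
move=> sz; rewrite /ev2 /horner_morph (@horner_coef_wide _ n).
  by apply: eq_bigr => i _; rewrite coef_map.
exact: leq_trans (size_poly _ _) _.
Qed.

Lemma ev2_swap x z (c : {poly {poly E}}) : ev2 z x (swapXY c) = ev2 x z c.
Proof.
have [n sn snY] : exists2 n, (size c <= n)%N & (sizeY c <= n)%N.
  by exists (maxn (size c) (sizeY c)); rewrite ?leq_maxl ?leq_maxr.
have sn' : (size (swapXY c) <= n)%N by rewrite -sizeYE.
rewrite (ev2_sum _ _ sn) (ev2_sum _ _ sn').
have c1 (i : nat) : (size ((swapXY c)`_i)%R <= n)%N.
  by rewrite (leq_trans (max_size_coefXY _ _)) // sizeYE swapXYK.
have c2 (i : nat) : (size (c`_i)%R <= n)%N by rewrite (leq_trans (max_size_coefXY _ _)).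
under eq_bigr => i _ do rewrite (ev_sum _ (c1 i)) mulr_suml.
under [RHS]eq_bigr => i _ do rewrite (ev_sum _ (c2 i)) mulr_suml.
rewrite exchange_big /=; apply: eq_bigr => i _; apply: eq_bigr => j _.
by rewrite coef_swapXY -!mulrA [x ^+ j * _]mulrC.
Qed.

Definition transc x := forall c : {poly E}, ev x c = 0 -> c = 0.

Lemma ev2Z x z c f : ev2 x z (c *: f) = ev x c * ev2 x z f.
Proof. by rewrite -mul_polyC rmorphM /= ev2C. Qed.

(** A single relation is minimal in both degrees. Choose [size f] least, then [sizeY f] least; any
    relation is a multiple of [f] over E(x), and by Gauss's lemma the multiplier has no
    denominator. *)
Lemma min_relation x z : transc x -> (exists2 f, f != 0 & ev2 x z f = 0) ->
  exists f : {poly {poly E}}, [/\ f != 0, ev2 x z f = 0,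
    forall c : {poly {poly E}}, (size c < size f)%N -> ev2 x z c = 0 -> c = 0 &
    forall c : {poly {poly E}}, (sizeY c < sizeY f)%N -> ev2 x z c = 0 -> c = 0].
Proof.
move=> tx [f0 f0_nz f00].
pose P n := `[< exists2 f : {poly {poly E}}, f != 0 /\ ev2 x z f = 0 & size f = n >].
have exP : exists n, P n by exists (size f0); apply/asboolP; exists f0.
have [n /asboolP[f1 f1P sf1] minn] := ex_minnP exP.
pose Q m := `[< exists2 f : {poly {poly E}}, f != 0 /\ ev2 x z f = 0 & size f = n /\ sizeY f = m >].
have exQ : exists m, Q m by exists (sizeY f1); apply/asboolP; exists f1.
have [m /asboolP[f [f_nz fxz] [sf sYf]] minm] := ex_minnP exQ.
have min1 (c : {poly {poly E}}) : (size c < size f)%N -> ev2 x z c = 0 -> c = 0.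
  move=> ltc cxz; apply/eqP; apply: contraLR ltc => c0; rewrite -leqNgt sf.
  by apply: minn; apply/asboolP; exists c.
exists f; split=> // g ltg gxz; apply/eqP; apply: contraLR ltg => g_nz; rewrite -leqNgt.
(* The pseudo-remainder of [g] by [f] is a relation of smaller degree in [z], hence zero. *)
have [c [q [c_nz ceq]]] : exists c q, c != 0 /\ c *: g = q * f.
  exists (lead_coef f ^+ scalp g f), (g %/ f); split.
    by rewrite expf_neq0 // lead_coef_eq0.
  rewrite Pdiv.Idomain.divp_eq [g %% f]min1 ?addr0 //; first by rewrite ltn_modp.
  have := congr1 (ev2 x z) (Pdiv.Idomain.divp_eq g f).
  by rewrite ev2Z gxz mulr0 rmorphD rmorphM /= fxz mulr0 add0r.
(* Strip the irreducible factors of [c] one by one: each must divide [q], since removing it from [f]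
   would lower [sizeY f]. *)
have [k szc] := ubnP (size c).
elim: k c q c_nz szc ceq => // k IHk c q c_nz szc ceq.
have cf_nz : c%:P != 0 by rewrite polyC_eq0.
have q_nz : q != 0.
  by apply: contraNneq g_nz => q0; move/eqP: ceq; rewrite q0 mul0r scale_poly_eq0 (negPf c_nz).
have [sc|sc] := leqP (size c) 1.
  have := congr1 sizeY ceq; rewrite -mul_polyC !sizeYM //.
  have -> : sizeY c%:P = 1%N.
    apply/eqP; rewrite eqn_leq lt0n sizeY_eq0 cf_nz andbT.
    by apply/bigmax_leqP => -[[|i] /= _] _; rewrite coefC //= size_poly0.
  rewrite add1n /= => ->.
  have : (0 < sizeY q)%N by rewrite lt0n sizeY_eq0.
  by case: (sizeY q) => // s _; rewrite addSn /= leq_addl.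
have [pi irr pic] := irreducible_dvdp sc.
have pi_nz : pi != 0 by rewrite irredp_neq0.
have [c' cE] : exists c', c = pi * c' by exists (c %/ pi); rewrite mulrC divpK.
have pi_qf i : pi %| (q * f)`_i by rewrite -ceq coefZ dvdp_mulr.
case: (gauss_irreducible irr pi_qf) => /polyC_dvd[h hE]; last first.
  have h_nz : h != 0.
    by apply: contraNneq f_nz => h0; rewrite hE h0 scaler0.
  have hxz : ev2 x z h = 0.
    move/eqP: fxz; rewrite hE ev2Z mulf_eq0 => /orP[/eqP/tx/eqP|/eqP//].
    by rewrite (negPf pi_nz).
  have : (m <= sizeY h)%N.
    apply: minm; apply/asboolP; exists h => //; split=> //.
    by rewrite -sf hE size_scale.
  rewrite -sYf hE -mul_polyC sizeYM ?polyC_eq0 //.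
  have -> : sizeY pi%:P = size pi.
    by rewrite /sizeY size_polyC pi_nz big_ord1 coefC.
  by move: (irr.1); case: (size pi) => [|[|a]] // _; rewrite !addSn /= ltnNge leq_addl.
have c'_nz : c' != 0 by apply: contraNneq c_nz => c'0; rewrite cE c'0 mulr0.
apply: (IHk c' h) => //.
  apply: leq_trans (szc : (size c <= k)%N); rewrite cE size_mul //.
  by move: (irr.1); case: (size pi) => [|[|a]] // _; rewrite !addSn ltnS leq_addl.
apply: (@mulfI _ pi%:P); rewrite ?polyC_eq0 // !mul_polyC scalerA -cE ceq hE.
by rewrite -scalerAl.
Qed.

End Eval.

(** * The rank of a monoid over a rational function field *)

Lemma sizeY_mul_leq (E : fieldType) (f g : {poly {poly E}}) :
  (sizeY (f * g) <= (sizeY f + sizeY g).-1)%N.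
Proof. by rewrite !sizeYE rmorphM; apply: size_polyMleq. Qed.

Lemma box_size (E : fieldType) (W W' C : {poly {poly E}}) (n2 n l e : nat) :
  (size W <= n2.+1)%N -> (size W' <= n2.+1)%N -> (size C <= e)%N -> (l <= n)%N ->
  (size (W ^+ l * W' ^+ (n - l) * C)%R <= n * n2 + e)%N.
Proof.
move=> sW sW' sC ln.
have sX (V : {poly {poly E}}) k : (size V <= n2.+1)%N -> (size (V ^+ k)%R <= (k * n2).+1)%N.
  move=> sV; apply: leq_trans (size_poly_exp_leq _ _) _.
  by rewrite ltnS mulnC leq_mul2l; case: (size V) sV => [|s] //= sV; rewrite ?leq0n ?(sV : (s <= n2)%N) orbT.
apply: leq_trans (size_polyMleq _ _) _.
have aux s1 s2 s3 s4 u1 u2 : (s1 <= u1.+1 -> s2 <= u2.+1 -> s3 <= (s1 + s2).-1 ->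
  s4 <= e -> (s3 + s4).-1 <= u1 + u2 + e)%N by lia.
have -> : (n * n2 = l * n2 + (n - l) * n2)%N by rewrite -mulnDl subnKC.
exact: aux (sX _ l sW) (sX _ (n - l)%N sW') (size_polyMleq _ _) sC.
Qed.

(** Bounds the codimension, inside an [al] by [be] box, of the multiples of a polynomial of bidegree
    [(a, b)]. *)
Lemma box_count al be a b :
  (al * be <= (al - a) * (be - b) + (a * be + b * al))%N.
Proof.
have [le_a|lt_a] := leqP a al; last first.
  have h : (al * be <= a * be)%N by rewrite leq_mul2r (ltnW lt_a) orbT.
  by apply: leq_trans h _; rewrite addnCA leq_addr.
have [le_b|lt_b] := leqP b be; last first.
  have h : (al * be <= b * al)%N by rewrite mulnC leq_mul2r (ltnW lt_b) orbT.
  by apply: leq_trans h _; rewrite addnA leq_addl.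
rewrite -{1}(subnK le_a) -{1}(subnK le_b) mulnDl mulnDr -addnA leq_add2l addnC.
by rewrite subnK // leq_add2l mulnC leq_mul2l leq_subr orbT.
Qed.

Lemma mono_coef (E : fieldType) (na nb : nat) (e : 'I_na * 'I_nb -> E) i j :
  (\sum_p (e p)%:P%:P * (('X^(p.1))%:P * 'X^(p.2)))`_(nat_of_ord j)`_(nat_of_ord i)
    = e (i, j).
Proof.
rewrite !coef_sum (bigD1 (i, j)) //= big1 ?addr0 => [|[i' j'] neq].
  by rewrite coefCM coefCM coefCM coefXn eqxx mulr1 coefXn eqxx mulr1.
rewrite /= coefCM coefCM coefCM !coefXn.
case: eqVneq => [ej|nj]; last by rewrite mulr0 coef0 mulr0.
rewrite mulr1 coefXn; case: eqVneq => [ei|ni]; last by rewrite mulr0.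
by case/eqP: neq; congr (_, _); apply/val_inj.
Qed.

Lemma big_option (V : nmodType) (I : finType) (F : option I -> V) :
  \sum_o F o = F None + \sum_i F (Some i).
Proof.
rewrite (bigD1 None) //=; congr (_ + _); rewrite (reindex_omap Some id) => [|[]] //.
by apply: eq_bigl => i; rewrite eqxx.
Qed.

Lemma sum_pair (V : nmodType) (I J : finType) (F : I * J -> V) :
  \sum_h F h = \sum_i \sum_j F (i, j).
Proof. by rewrite pair_bigA; apply: eq_bigr => -[]. Qed.

Section Rank.
Variables (E K : fieldType) (iota : {rmorphism E -> K}) (A : K -> Prop).
Local Notation ev := (ev iota).
Local Notation ev2 := (ev2 iota).
Local Notation transc := (transc iota).

(** Independence over E(z), denominators cleared. Asking for [c i = 0] as a polynomial leaves only
    the empty family when [z] is algebraic over E. *)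
Definition ind z (I : finType) (m : I -> K) := forall c : I -> {poly E},
  \sum_i ev z (c i) * m i = 0 -> forall i, c i = 0.
(** Independence over E(x, z). A coefficient may be a nonzero relation between [x] and [z], so only
    its value has to vanish. *)
Definition ind2 x z (I : finType) (m : I -> K) := forall c : I -> {poly {poly E}},
  \sum_i ev2 x z (c i) * m i = 0 -> forall i, ev2 x z (c i) = 0.
Definition frac_span x z d (m : 'I_d -> K) := forall u, A u ->
  exists q, ev2 x z q != 0 /\
    exists c : 'I_d -> {poly {poly E}}, ev2 x z q * u = \sum_k ev2 x z (c k) * m k.

Hypothesis A1 : A 1.
Hypothesis AM : forall x y, A x -> A y -> A (x * y).
Hypothesis bounded : forall z, transc z ->
  exists n, forall R (m : 'I_R -> K), (forall i, A (m i)) -> ind z m -> (R <= n)%N.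

Lemma ind_transc z R (m : 'I_R -> K) : ind z m -> (0 < R)%N -> transc z.
Proof.
move=> indm R_gt0 c cz; apply: (indm (fun=> c) _ (Ordinal R_gt0)).
by rewrite big1 // => i _; rewrite cz mul0r.
Qed.

Lemma rank_ex z : exists n,
  (exists2 m : 'I_n -> K, forall i, A (m i) & ind z m) /\
  forall R (m : 'I_R -> K), (forall i, A (m i)) -> ind z m -> (R <= n)%N.
Proof.
have [tz|ntz] := pselect (transc z); last first.
  exists 0%N; split=> [|[|R] m _ indm] //; last by case: ntz; exact: ind_transc indm _.
  by exists (fun=> 0) => [[]//|c _ []].
have [n0 n0P] := bounded tz.
pose P n := `[< exists2 m : 'I_n -> K, forall i, A (m i) & ind z m >].
have exP : exists n, P n.
  by exists 0%N; apply/asboolP; exists (fun=> 0) => [[]//|c _ []].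
have leP n : P n -> (n <= n0)%N by move=> /asboolP[m Am indm]; exact: n0P indm.
have [n /asboolP Pn maxn] := ex_maxnP exP leP.
by exists n; split=> // R m Am indm; apply: maxn; apply/asboolP; exists m.
Qed.

Definition ht z : nat := projT1 (cid (rank_ex z)).

Lemma htP z : exists2 m : 'I_(ht z) -> K, forall i, A (m i) & ind z m.
Proof. by rewrite /ht; case: (cid _) => n []. Qed.

Lemma ind_card z (I : finType) (m : I -> K) :
  (forall i, A (m i)) -> ind z m -> (#|I| <= ht z)%N.
Proof.
move=> Am indm; rewrite /ht; case: (cid _) => n [_ /=].
apply=> [i|c c0]; first exact: (Am (enum_val i)).
move=> i; have := indm (fun j => c (enum_rank j)) _ (enum_val i).
rewrite enum_valK; apply; rewrite -[RHS]c0.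
rewrite [RHS](reindex (@enum_rank I)) /=; last exact/onW_bij/enum_rank_bij.
by apply: eq_bigr => k _; rewrite enum_rankK.
Qed.

Lemma ht_gt0 z : transc z -> (0 < ht z)%N.
Proof.
move=> tz; have := @ind_card z unit (fun=> 1) (fun=> A1).
rewrite card_unit; apply=> c; rewrite (bigD1 tt) //= big1 ?addr0 => [|[]//].
by rewrite mulr1 => /tz c0 [].
Qed.

Lemma ht_transc z : (0 < ht z)%N -> transc z.
Proof. by have [m _ indm] := htP z; exact: ind_transc indm. Qed.

(** Here [d] is the rank of [A] over E(x, z), which is finite because independence over E(x, z)
    implies independence over E(x). *)
Lemma ind2_max x z : transc x -> exists d, exists m : 'I_d -> K,
  [/\ forall i, A (m i), ind2 x z m & frac_span x z m].
Proof.
move=> tx.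
pose P n := `[< exists2 m : 'I_n -> K, forall i, A (m i) & ind2 x z m >].
have exP : exists n, P n.
  by exists 0%N; apply/asboolP; exists (fun=> 0) => [[]//|c _ []].
have leP n : P n -> (n <= ht x)%N.
  move=> /asboolP[m Am indm]; rewrite -[n]card_ord; apply: (ind_card Am) => c c0 i.
  apply/tx; rewrite -(ev2C iota x z); apply: (indm (fun i => (c i)%:P)) => //.
  by rewrite -[RHS]c0; apply: eq_bigr => j _; rewrite ev2C.
have [d /asboolP[m Am indm] maxd] := ex_maxnP exP leP.
exists d, m; split=> // u Au.
pose m' (o : option 'I_d) := if o is Some k then m k else u.
have ninj : ~ ind2 x z m'.
  move=> indm'; have : P #|{: option 'I_d}|; last first.
    by move/maxd; rewrite card_option card_ord ltnn.
  apply/asboolP; exists (fun i => m' (enum_val i)) => [i|c c0 i].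
    by case: (enum_val i).
  have := indm' (fun j => c (enum_rank j)) _ (enum_val i).
  rewrite enum_valK; apply; rewrite -[RHS]c0.
  rewrite [RHS](reindex (@enum_rank _)) /=; last exact/onW_bij/enum_rank_bij.
  by apply: eq_bigr => k _; rewrite enum_rankK.
have [c /not_implyP[c0 /existsNP[o /eqP co]]] := (existsNP _).2 ninj.
have {}c0 : ev2 x z (c None) * u + \sum_k ev2 x z (c (Some k)) * m k = 0.
  by rewrite -[RHS]c0 big_option.
exists (c None); split; last first.
  exists (fun k => - c (Some k)); move/eqP: c0; rewrite addr_eq0 => /eqP ->.
  by rewrite -sumrN; apply: eq_bigr => k _; rewrite ev2N mulNr.
apply: contraNneq co => cN; move: c0; rewrite cN mul0r add0r => c0.
by case: o => [k|]; rewrite ?cN //; apply/eqP/(indm (fun k => c (Some k))).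
Qed.

(** Half of the tower law: the powers of [z] below [b] are free over E(x), hence so are their
    products with the [m k]. *)
Lemma ht_lower x z d b (m : 'I_d -> K) : A z -> (forall i, A (m i)) -> ind2 x z m ->
  (forall c : {poly {poly E}}, (size c <= b)%N -> ev2 x z c = 0 -> c = 0) ->
  (d * b <= ht x)%N.
Proof.
move=> Az Am indm minb.
have AX k : A (z ^+ k) by elim: k => [|k IH]; rewrite ?expr0 // exprS; apply: AM.
have := @ind_card x ('I_d * 'I_b)%type (fun p => z ^+ p.2 * m p.1).
rewrite card_prod !card_ord; apply=> [[k j]|c c0]; first exact: AM.
pose C k := \poly_(j < b) (if insub j is Some j' then c (k, j') else 0).
have CE k (j : 'I_b) : (C k)`_j = c (k, j).
  by rewrite coef_poly ltn_ord insubT //= => lt; congr (c (k, _)); apply/val_inj.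
have C0 k : C k = 0.
  apply: minb; first exact: size_poly.
  apply: (indm C); rewrite -[RHS]c0.
  under eq_bigr => i _ do rewrite (ev2_sum _ _ _ (size_poly _ _)) mulr_suml.
  by rewrite pair_bigA; apply: eq_bigr => -[i j] _; rewrite CE mulrA.
by case=> k j; rewrite -CE C0 coef0.
Qed.

Lemma ind2_swap x z d (m : 'I_d -> K) : ind2 x z m -> ind2 z x m.
Proof.
move=> indm c c0 i; rewrite -[c i]swapXYK ev2_swap.
apply: (indm (fun i => swapXY (c i))); rewrite -[RHS]c0.
by apply: eq_bigr => j _; rewrite ev2_swap.
Qed.

(** The element [s] is a quotient of forms of bidegree [(n1, n2)] on the curve [f = 0] of bidegree
    [(a, b)], so its degree is at most the intersection number [a * n2 + b * n1]. The proof counts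
    dimensions in a large box. *)
Lemma ht_upper x z (f : {poly {poly E}}) a b d (m : 'I_d -> K)
    (W W' : {poly {poly E}}) s n1 n2 :
    f != 0 -> ev2 x z f = 0 -> (size f <= b.+1)%N -> (sizeY f <= a.+1)%N ->
    frac_span x z m ->
    (size W <= n2.+1)%N -> (sizeY W <= n1.+1)%N ->
    (size W' <= n2.+1)%N -> (sizeY W' <= n1.+1)%N ->
    ev2 x z W' != 0 -> s * ev2 x z W' = ev2 x z W ->
  (ht s <= d * (a * n2 + b * n1))%N.
Proof.
move=> f_nz fxz sf sYf spm sW sYW sW' sYW' W'_nz sE.
have [u Au indu] := htP s; rewrite leqNgt; apply/negP => ltR.
have /choice[q /all_and2[q_nz qP]] : forall i, exists q, ev2 x z q != 0 /\
    exists c : 'I_d -> {poly {poly E}}, ev2 x z q * u i = \sum_k ev2 x z (c k) * m k.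
  by move=> i; exact: spm (Au i).
have /choice[c cP] := qP.
(* Common denominator [Q] for the coordinates of all [u i] in the basis [m]. *)
pose Q := \prod_i q i; pose C i k := (\prod_(j | j != i) q j) * c i k.
have Q_nz : ev2 x z Q != 0 by rewrite rmorph_prod; apply/prodf_neq0 => i _; exact: q_nz.
have CP i : ev2 x z Q * u i = \sum_k ev2 x z (C i k) * m k.
  rewrite /Q (bigD1 i) //= mulrC rmorphM /= mulrA mulrC [u i * _]mulrC cP mulr_sumr.
  by apply: eq_bigr => k _; rewrite rmorphM mulrA.
have [e sC sYC] : exists2 e, forall i k, (size (C i k) <= e)%N &
    forall i k, (sizeY (C i k) <= e)%N.
  exists (\max_i \max_k maxn (size (C i k)) (sizeY (C i k))) => i k.
    by apply: leq_trans (leq_bigmax i); apply: leq_trans (leq_bigmax k); apply: leq_maxl.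
  by apply: leq_trans (leq_bigmax i); apply: leq_trans (leq_bigmax k); apply: leq_maxr.
(* This [n] equals the error term caused by [e], so [ht s * n.+1] exceeds the number of dimensions
   missed by the multiples of [f]. *)
have [n nE] : exists n, n = (d * (a + b) * e)%N by exists (d * (a + b) * e)%N.
pose al := (n * n1 + e)%N; pose be := (n * n2 + e)%N.
(* The left summand carries the coordinates of [s ^ l * u i], cleared of denominators; the right one
   carries the monomial multiples of [f] in each slot. *)
pose v (h : ('I_(ht s) * 'I_n.+1) + ('I_d * ('I_(al - a) * 'I_(be - b)))) (k : 'I_d) :
    {poly {poly E}} :=
  match h with
  | inl (i, l) => W ^+ l * W' ^+ (n - l) * C i k
  | inr (k0, (i, j)) => (k == k0)%:R * (f * (('X^i)%:P * 'X^j))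
  end.
have aux s1 s2 u1 u2 w : (s1 <= u1.+1 -> s2 <= u2.+1 -> u1 + u2 < w ->
  (s1 + s2).-1 <= w)%N by lia.
have sv h k : (size (v h k) <= be)%N.
  case: h => [[i l]|[k0 [i j]]] /=; first by apply: box_size => //; rewrite -ltnS.
  case: (k == k0); rewrite ?mul0r ?size_poly0 // mul1r.
  have ltj : (b + j < be)%N by rewrite -ltn_subRL.
  apply: leq_trans (size_polyMleq _ _) _; apply: (aux _ _ _ _ _ sf) ltj.
  apply: leq_trans (size_polyMleq _ _) _.
    by rewrite size_polyXn addnS /= -add1n leq_add2r size_polyC_leq1.
have svY h k : (sizeY (v h k) <= al)%N.
  case: h => [[i l]|[k0 [i j]]] /=.
    rewrite sizeYE rmorphM rmorphM !rmorphXn /=; apply: (@box_size _ (swapXY W) (swapXY W') (swapXY (C i k))).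
    + by rewrite -sizeYE.
    + by rewrite -sizeYE.
    + by rewrite -sizeYE; exact: sYC.
    + by rewrite -ltnS.
  case: (k == k0); last by rewrite mul0r sizeYE rmorph0 size_poly0.
  rewrite mul1r; apply: leq_trans (sizeY_mul_leq _ _) _.
  have lti : (a + i < al)%N by rewrite -ltn_subRL.
  apply: (aux _ _ _ _ _ sYf) lti.
  rewrite sizeYE rmorphM /= swapXY_polyC [swapXY 'X^_]rmorphXn /= swapXY_X map_polyXn.
  apply: leq_trans (size_polyMleq _ _) _; rewrite -polyC_exp size_polyXn addSn /= -addn1.
  by rewrite leq_add2l size_polyC_leq1.
have [|g [h0 g_nz] g0] := bipoly_dep sv svY.
  rewrite card_sum !card_prod !card_ord.
  have : (d * (al * be) <= d * ((al - a) * (be - b)) + d * (a * be + b * al))%N.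
    rewrite -mulnDr leq_mul2l; apply/orP; right.
    exact: box_count.
  have : (d * (a * be + b * al) < ht s * n.+1)%N.
    apply: leq_trans (leq_mul ltR (leqnn n.+1)).
    have -> : (d * (a * be + b * al) = n * (d * (a * n2 + b * n1)) + n)%N.
      by rewrite [X in (_ = _ + X)%N]nE /al /be; ring.
    by move: (d * _)%N => D; lia.
  by move=> h1 h2; apply: leq_ltn_trans h2 _; rewrite addnC ltn_add2r.
(* Evaluation kills the multiples of [f] and leaves a relation among the [u i] whose coefficients
   are polynomials in [s]. *)
have ginl i l : g (inl (i, l)) = 0.
  pose e1 i := \poly_(l < n.+1) (if insub l is Some l' then g (inl (i, l')) else 0).
  have e1E i' (l' : 'I_n.+1) : (e1 i')`_l' = g (inl (i', l')).
    by rewrite coef_poly ltn_ord insubT //= => lt; congr (g (inl (_, _))); apply/val_inj.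
  suff e10 : e1 i = 0 by rewrite -e1E e10 coef0.
  apply: indu; apply: (mulfI Q_nz); apply: (mulfI (expf_neq0 n W'_nz)).
  rewrite !mulr0 mulrA mulr_sumr.
  have E1 k : \sum_i0 \sum_l0 iota (g (inl (i0, l0))) *
       (ev2 x z W ^+ l0 * ev2 x z W' ^+ (n - l0) * ev2 x z (C i0 k)) = 0.
    have := congr1 (ev2 x z) (g0 k); rewrite rmorph0 => g0k; rewrite -[RHS]g0k.
    rewrite big_sumType rmorphD [X in _ = _ + X](_ : _ = 0) ?addr0; last first.
      rewrite rmorph_sum big1 //= => -[k0 [i0 j0]] _.
      by rewrite !ev2M fxz mul0r !mulr0.
    rewrite rmorph_sum pair_bigA; apply: eq_bigr => -[i0 l0] _ /=.
    by rewrite !ev2M !rmorphXn /= ev2C evC.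
  transitivity (\sum_k (\sum_i0 \sum_l0 iota (g (inl (i0, l0))) *
       (ev2 x z W ^+ l0 * ev2 x z W' ^+ (n - l0) * ev2 x z (C i0 k))) * m k); last first.
    by rewrite big1 // => k _; rewrite E1 mul0r.
  under [RHS]eq_bigr => k _ do rewrite mulr_suml.
  rewrite exchange_big; apply: eq_bigr => i0 _ /=.
  under [RHS]eq_bigr => k _ do rewrite mulr_suml.
  rewrite exchange_big /= (ev_sum _ _ (size_poly _ _)) !mulr_suml mulr_sumr.
  apply: eq_bigr => l0 _; rewrite e1E.
  under [RHS]eq_bigr => k _ do rewrite -!mulrA.
  rewrite -mulr_sumr -mulr_sumr -mulr_sumr -CP -sE exprMn.
  have -> : ev2 x z W' ^+ n = ev2 x z W' ^+ l0 * ev2 x z W' ^+ (n - l0).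
    by rewrite -exprD subnKC // -ltnS.
  by ring.
(* Only multiples of [f] remain; cancelling [f] leaves a vanishing combination of distinct
   monomials. *)
case: h0 g_nz => [[i l]|[k [i j]]]; rewrite ?ginl ?eqxx //.
have := g0 k; rewrite big_sumType /= big1 ?add0r; last first.
  by move=> [i0 l0] _; rewrite ginl !polyC0 mul0r.
rewrite sum_pair /=.
rewrite (bigD1 k) //= [X in _ + X]big1 ?addr0; last first.
  move=> k0 nk; rewrite big1 // => -[i0 j0] _.
  by rewrite eq_sym (negPf nk) mul0r mulr0.
have -> : \sum_p (g (inr (k, p)))%:P%:P * (let (i0, j0) := p in
     (k == k)%:R * (f * (('X^i0)%:P * 'X^j0))) =
   f * \sum_p (g (inr (k, p)))%:P%:P * (('X^(p.1))%:P * 'X^(p.2)).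
  by rewrite mulr_sumr; apply: eq_bigr => -[i0 j0] _; rewrite eqxx mul1r mulrCA.
move/eqP; rewrite mulf_eq0 (negPf f_nz) /= => /eqP G0 /negP[].
by rewrite -(mono_coef (fun p => g (inr (k, p)))) G0 !coef0.
Qed.

End Rank.

(** * Height inequalities *)

Lemma size_mul_le (R : nzRingType) (p q : {poly R}) m n :
  (size p <= m.+1)%N -> (size q <= n.+1)%N -> (size (p * q)%R <= (m + n).+1)%N.
Proof.
move=> sp sq; apply: leq_trans (size_polyMleq _ _) _.
by rewrite -subn1 leq_subLR add1n -addSn -addnS leq_add.
Qed.

Section Heights.
Variables (E K : fieldType) (iota : {rmorphism E -> K}) (A : K -> Prop).
Local Notation ev := (ev iota).
Local Notation ev2 := (ev2 iota).
Local Notation transc := (transc iota).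
Local Notation ind := (ind iota).
Local Notation ind2 := (ind2 iota).

Hypothesis A1 : A 1.
Hypothesis AM : forall x y, A x -> A y -> A (x * y).
Hypothesis bounded : forall z, transc z ->
  exists n, forall R (m : 'I_R -> K), (forall i, A (m i)) -> ind z m -> (R <= n)%N.
Hypothesis dep : forall x z, transc x -> exists2 f, f != 0 & ev2 x z f = 0.
Local Notation ht := (ht bounded).

Lemma ntranscP x : ~ transc x <-> algebraicOver iota x.
Proof.
split=> [/existsNP[c /not_implyP[cx /eqP c0]]|[c c0 /eqP cx] tx]; first by exists c => //; apply/eqP.
by move/eqP: c0; apply; apply: tx.
Qed.

Lemma ht_alg x : algebraicOver iota x -> ht x = 0%N.
Proof.
by move/ntranscP => nt; apply/eqP; rewrite -leqn0 leqNgt; apply/negP => /ht_transc.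
Qed.

Lemma ht_lowerY x z a d (m : 'I_d -> K) : A x -> (forall i, A (m i)) -> ind2 x z m ->
  (forall c : {poly {poly E}}, (sizeY c <= a)%N -> ev2 x z c = 0 -> c = 0) ->
  (d * a <= ht z)%N.
Proof.
move=> Ax Am indm mina; apply: (ht_lower A1 AM bounded Ax Am (ind2_swap indm)) => c sc c0.
apply/eqP; rewrite -swapXY_eq0; apply/eqP/mina; first by rewrite sizeYE swapXYK.
by rewrite ev2_swap.
Qed.

(** For a minimal relation of degree [a] in [x] and [b] in [y], [ht x] is at least [d * b] and
    [ht y] at least [d * a], while [x * y] has bidegree [(1, 1)], so [ht_upper] gives
    [d * (a + b)]. *)
Lemma ht_mul_transc x y : transc x -> A x -> A y -> (ht (x * y) <= ht x + ht y)%N.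
Proof.
move=> tx Ax Ay; have [d [m [Am indm spm]]] := ind2_max bounded y tx.
have [f [f_nz fxy minf minYf]] := min_relation tx (dep y tx).
have sf : (0 < size f)%N by rewrite size_poly_gt0.
have sYf : (0 < sizeY f)%N by rewrite lt0n sizeY_eq0.
have lx : (d * (size f).-1 <= ht x)%N.
  by apply: (ht_lower A1 AM _ Ay Am indm) => c sc; apply: minf; rewrite -ltnS prednK in sc.
have ly : (d * (sizeY f).-1 <= ht y)%N.
  by apply: (ht_lowerY Ax Am indm) => c sc; apply: minYf; rewrite -ltnS prednK in sc.
apply: leq_trans (leq_add lx ly); rewrite -mulnDr addnC.
have := @ht_upper _ _ _ _ bounded x y f (sizeY f).-1 (size f).-1 d m
  ('X%:P * 'X) 1 (x * y) 1 1 f_nz fxy; rewrite !muln1; apply=> //.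
- by rewrite prednK.
- by rewrite prednK.
- by apply: leq_trans (size_polyMleq _ _) _; rewrite size_polyX addn2 /= ltnS size_polyC_leq1.
- apply: leq_trans (sizeY_mul_leq _ _) _; rewrite !sizeYE swapXY_polyC swapXY_X map_polyX.
  by rewrite size_polyX add2n /= ltnS size_polyC_leq1.
- by rewrite size_poly1.
- by rewrite sizeYE rmorph1 size_poly1.
- by rewrite rmorph1 oner_neq0.
- by rewrite rmorph1 mulr1 ev2M ev2C evX ev2X.
Qed.

Lemma ht_mul x y : A x -> A y -> (ht (x * y) <= ht x + ht y)%N.
Proof.
move=> Ax Ay; have [tx|/ntranscP ax] := pselect (transc x); first exact: ht_mul_transc.
have [ty|/ntranscP ay] := pselect (transc y).
  by rewrite mulrC addnC; apply: ht_mul_transc.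
by rewrite ht_alg //; apply: algebraic_mul.
Qed.

(** E(w) lies in E(x), so a family free over E(x) stays free over E(w). *)
Lemma ht_rational x w (P Q : {poly E}) :
  w * ev x Q = ev x P -> ev x Q != 0 -> transc w -> (ht x <= ht w)%N.
Proof.
move=> wE Qx_nz tw; have [m Am indm] := htP bounded x.
rewrite -[ht x]card_ord; apply: (ind_card _ Am) => c c0.
pose D := \max_i size (c i).
pose H i := \sum_(j < D) (c i)`_j *: (P ^+ j * Q ^+ (D - j)).
have HE i : ev x (H i) = ev x Q ^+ D * ev w (c i).
  have sc : (size (c i) <= D)%N by exact: leq_bigmax.
  rewrite (ev_sum _ _ sc) mulr_sumr rmorph_sum; apply: eq_bigr => j _.
  rewrite -mul_polyC !rmorphM !rmorphXn /= evC -wE exprMn.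
  have -> : ev x Q ^+ D = ev x Q ^+ j * ev x Q ^+ (D - j).
    by rewrite -exprD subnKC // ltnW.
  by rewrite [LHS]mulrC -!mulrA [LHS]mulrC -!mulrA.
move=> i; apply: tw; apply: (mulfI (expf_neq0 D Qx_nz)); rewrite -HE mulr0.
rewrite (indm H) ?rmorph0 //.
under eq_bigr => k _ do rewrite HE -mulrA.
by rewrite -mulr_sumr c0 mulr0.
Qed.

Lemma ht_inv x : ht x^-1 = ht x.
Proof.
have le y : (ht y <= ht y^-1)%N.
  have [ty|/ntranscP/ht_alg -> //] := pselect (transc y).
  have y_nz : y != 0 by apply/eqP => y0; have := ty 'X; rewrite evX => /(_ y0) /eqP; rewrite polyX_eq0.
  apply: (@ht_rational _ _ 1 'X); rewrite ?rmorph1 ?evX ?mulVf //.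
  move: ty; apply: contraPP => /ntranscP /algebraic_inv; rewrite invrK.
  by move/ntranscP.
by apply/eqP; rewrite eqn_leq le -{2}[x]invrK le.
Qed.

Lemma ht_sub1 x : ht (1 - x) = ht x.
Proof.
have le y : (ht y <= ht (1 - y))%N.
  have [ty|/ntranscP/ht_alg -> //] := pselect (transc y).
  apply: (@ht_rational _ _ (1 - 'X) 1); rewrite ?rmorph1 ?oner_neq0 //.
    by rewrite mulr1 rmorphB rmorph1 /= evX.
  move: ty; apply: contraPP => /ntranscP /(algebraic_sub (algebraic1 iota)).
  by rewrite opprB addrC subrK => /ntranscP.
by apply/eqP; rewrite eqn_leq le -{2}[x](subKr 1) le.
Qed.

(** If the [m j] are free over E(x), their products with the powers of [x] below [n] are free over
    E(x^n): exponents of [x] are separated modulo [n]. *)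
Lemma ht_exp n x : A x -> (n * ht x <= ht (x ^+ n))%N.
Proof.
case: n => [|n] // Ax; have [m Am indm] := htP bounded x.
have AX k : A (x ^+ k) by elim: k => [|k IH]; rewrite ?expr0 // exprS; apply: AM.
have := @ind_card _ _ _ _ bounded (x ^+ n.+1) ('I_n.+1 * 'I_(ht x))%type
  (fun p => x ^+ p.1 * m p.2).
rewrite card_prod !card_ord; apply=> [[i j]|c c0]; first exact: AM.
pose H (j : 'I_(ht x)) : {poly E} := \sum_(i < n.+1) 'X^i * (c (i, j) \Po 'X^(n.+1)).
have evcomp (q : {poly E}) : ev x (q \Po 'X^(n.+1)) = ev (x ^+ n.+1) q.
  rewrite comp_polyE [RHS](ev_sum _ _ (leqnn _)) rmorph_sum; apply: eq_bigr => i _.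
  by rewrite -mul_polyC rmorphM !rmorphXn /= evC evX.
have H0 j : H j = 0.
  apply: (indm H); rewrite -[RHS]c0 sum_pair exchange_big; apply: eq_bigr => j' _ /=.
  rewrite rmorph_sum mulr_suml; apply: eq_bigr => i _.
  by rewrite rmorphM rmorphXn /= evX evcomp -mulrA mulrCA.
case=> i j; apply/polyP => q; rewrite coef0.
have := congr1 (fun u : {poly E} => u`_(q * n.+1 + i)) (H0 j).
rewrite coef0 coef_sum (bigD1 i) //= big1 ?addr0 => [|i' ni].
  rewrite coefXnM ltnNge leq_addl /= addnK coef_comp_poly_Xn // dvdn_mull // mulnK //.
rewrite coefXnM; case: ltnP => // le; rewrite coef_comp_poly_Xn //.
case: ifP => // dv; case/eqP: ni; apply/val_inj => /=.
have : (q * n.+1 + i = i' %[mod n.+1])%N.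
  by rewrite -{1}(subnK le) -modnDml (eqP dv) add0n.
by rewrite modnMDl !modn_small.
Qed.

(** This is [V ^ b] times the value of [c] at [U / V], the homogenization of [c] in its outer
    variable. *)
Definition homog b (U V : {poly {poly E}}) (c : {poly {poly E}}) :=
  \sum_(j < b.+1) (c`_j)%:P * U ^+ j * V ^+ (b - j).
Definition homogC b (u v : {poly E}) (c : {poly {poly E}}) :=
  \sum_(j < b.+1) c`_j * u ^+ j * v ^+ (b - j).

Lemma ev2_homog b x z w U V (c : {poly {poly E}}) : (size c <= b.+1)%N ->
  ev2 x z U = w * ev2 x z V -> ev2 x z (homog b U V c) = ev2 x z V ^+ b * ev2 x w c.
Proof.
move=> sc UE; rewrite (ev2_sum _ _ _ sc) mulr_sumr rmorph_sum; apply: eq_bigr => j _ /=.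
rewrite !ev2M !rmorphXn /= ev2C UE exprMn.
have -> : ev2 x z V ^+ b = ev2 x z V ^+ j * ev2 x z V ^+ (b - j).
  by rewrite -exprD subnKC // -ltnS.
by rewrite -!mulrA [RHS]mulrC -!mulrA [RHS]mulrC -!mulrA.
Qed.

Lemma ev_homogC b x w u v (c : {poly {poly E}}) : (size c <= b.+1)%N ->
  ev x u = w * ev x v -> ev x (homogC b u v c) = ev x v ^+ b * ev2 x w c.
Proof.
move=> sc UE; rewrite (ev2_sum _ _ _ sc) mulr_sumr rmorph_sum; apply: eq_bigr => j _ /=.
rewrite !rmorphM !rmorphXn /= UE exprMn.
have -> : ev x v ^+ b = ev x v ^+ j * ev x v ^+ (b - j).
  by rewrite -exprD subnKC // -ltnS.
by rewrite -!mulrA [RHS]mulrC -!mulrA [RHS]mulrC -!mulrA.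
Qed.

Lemma size_linear_exp (P : {poly E}) j :
  (size ((1 - P%:P * 'X) ^+ j : {poly {poly E}})%R <= j.+1)%N.
Proof.
have sU : (size (1 - P%:P * 'X : {poly {poly E}})%R <= 2)%N.
  rewrite (leq_trans (size_polyD _ _)) // geq_max size_poly1 size_polyN /=.
  by apply: leq_trans (size_polyMleq _ _) _; rewrite size_polyX addn2 /= ltnS size_polyC_leq1.
apply: leq_trans (size_poly_exp_leq _ _) _; rewrite ltnS -{2}[j]mul1n leq_mul2r.
by rewrite -subn1 leq_subLR add1n sU orbT.
Qed.

Lemma coef_homog_lead b (P Q : {poly E}) (c : {poly {poly E}}) :
  (homog b (1 - P%:P * 'X) Q%:P c)`_b = c`_b * (- P) ^+ b.
Proof.
have cX j : ((1 - P%:P * 'X : {poly {poly E}}) ^+ j)`_j = (- P) ^+ j.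
  elim: j => [|j IH]; first by rewrite !expr0 coef1.
  rewrite exprS mulrBl mul1r coefB nth_default ?size_linear_exp // sub0r -mulrA coefCM.
  by rewrite coefXM /= IH exprS mulNr.
rewrite coef_sum big_ord_recr /= subnn expr0 mulr1 coefCM cX big1 ?add0r // => j _.
rewrite -polyC_exp coefMC coefCM (nth_default 0 (leq_trans (size_linear_exp P j) _)) ?mulr0 ?mul0r //.

Qed.

Lemma size_homog b (P Q : {poly E}) (c : {poly {poly E}}) :
  (size (homog b (1 - P%:P * 'X) Q%:P c) <= b.+1)%N.
Proof.
apply: (leq_trans (size_sum _ _ _)); apply/bigmax_leqP => j _.
rewrite -polyC_exp mulrC mulrA -polyCM [(_ * c`_j)%:P * _]mul_polyC.
apply: leq_trans (size_scale_leq _ _) _.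
by apply: leq_trans (size_linear_exp _ _) _.
Qed.

Lemma ev2_linear x z (P : {poly E}) : ev2 x z (1 - P%:P * 'X) = 1 - ev x P * z.
Proof.
by rewrite ev2B ev2_1 ev2M ev2C ev2X.
Qed.

Lemma sub1_mul (u z1 v z2 : K) : u * z1 + v * z2 = 1 -> 1 - u * z1 = z2 * v.
Proof. by move=> <-; rewrite addrAC subrr add0r mulrC. Qed.

(* [P z1 + Q z2 = 1] makes [z2] a Moebius transform of [z1] over [E(x)]. *)
Lemma moebius_size x z1 z2 (P Q : {poly E}) (g1 g2 : {poly {poly E}}) :
  transc x -> P != 0 -> ev x P * z1 + ev x Q * z2 = 1 -> g2 != 0 -> ev2 x z2 g2 = 0 ->
  (forall c : {poly {poly E}}, (size c < size g1)%N -> ev2 x z1 c = 0 -> c = 0) ->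
  (size g1 <= size g2)%N.
Proof.
move=> tx P_nz Pz g2_nz g20 min1; rewrite leqNgt; apply/negP => lt.
have s2 : (0 < size g2)%N by rewrite size_poly_gt0.
pose b := (size g2).-1; have bE : (b.+1 = size g2)%N by rewrite prednK.
have h0 : homog b (1 - P%:P * 'X) Q%:P g2 = 0.
  apply: min1; first by rewrite (leq_ltn_trans (size_homog _ _ _ _)) // bE.
  rewrite (@ev2_homog _ _ _ z2) ?g20 ?mulr0 ?bE //.
  by rewrite ev2_linear ev2C (sub1_mul Pz).
have := coef_homog_lead b P Q g2; rewrite h0 coef0 => /esym/eqP.
by rewrite mulf_eq0 expf_eq0 oppr_eq0 (negPf P_nz) andbF orbF lead_coef_eq0 (negPf g2_nz).
Qed.

(** The minimal relations [g1], [g2] of [z1], [z2] over E[x] have the same degree [k] and correspond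
    under the Moebius map. Evaluated at the solution [w = - a / c] of the second linear relation,
    they give an identity in E[x] in which [Q ^ k] divides a nonzero polynomial of bounded
    degree. *)
Lemma ht_key x z1 z2 n N (P Q a b c : {poly E}) :
    A x -> A z1 -> A z2 -> P != 0 -> coprimep Q P -> size Q = n.+1 ->
    (size a <= N.+1)%N -> (size c <= N.+1)%N ->
    a * P + b * Q + c = 0 -> c != 0 ->
    ev x P * z1 + ev x Q * z2 = 1 -> ev x c * z1 + ev x a != 0 ->
  ((n - N) * ht x <= ht z1 + ht z2)%N.
Proof.
move=> Ax Az1 Az2 P_nz copQP sQ sa sc abc0 c_nz Pz nondeg.
have [tx|/ntranscP/ht_alg ->] := pselect (transc x); last by rewrite muln0.
have ev_nz (q : {poly E}) : q != 0 -> ev x q != 0 by apply: contraNneq => /tx/eqP.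
have Q_nz : Q != 0 by rewrite -size_poly_eq0 sQ.
have [d [m [Am indm spm]]] := ind2_max bounded z1 tx.
have [g1 [g1_nz g10 min1 minY1]] := min_relation tx (dep z1 tx).
have [g2 [g2_nz g20 min2 minY2]] := min_relation tx (dep z2 tx).
have s1 : (0 < size g1)%N by rewrite size_poly_gt0.
have sE : size g2 = size g1.
  apply/eqP; rewrite eqn_leq (@moebius_size x z2 z1 Q P) ?(@moebius_size x z1 z2 P Q) //.
  by rewrite addrC.
pose k := (size g1).-1; have kE : (k.+1 = size g1)%N by rewrite prednK.
have kE2 : (k.+1 = size g2)%N by rewrite sE.
have sY1 : (0 < sizeY g1)%N by rewrite lt0n sizeY_eq0.
have sY2 : (0 < sizeY g2)%N by rewrite lt0n sizeY_eq0.
(* Here [ht_upper] is applied to [x] itself, of bidegree [(1, 0)]. *)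
have hx : (ht x <= d * k)%N.
  have := @ht_upper _ _ _ _ bounded x z1 g1 (sizeY g1).-1 k d m
    'X%:P 1 x 1 0 g1_nz g10; rewrite muln0 muln1 add0n; apply=> //.
  - by rewrite kE.
  - by rewrite prednK.
  - exact: size_polyC_leq1.
  - by rewrite sizeYE swapXY_polyC map_polyX size_polyX.
  - by rewrite size_poly1.
  - by rewrite sizeYE rmorph1 size_poly1.
  - by rewrite rmorph1 oner_neq0.
  - by rewrite rmorph1 mulr1 ev2C evX.
have h1 : (d * (sizeY g1).-1 <= ht z1)%N.
  by apply: (ht_lowerY Ax Am indm) => q sq; apply: minY1; rewrite -ltnS prednK in sq.
have indm2 : ind2 x z2 m.
  move=> q q0 i; pose D := \max_i size (q i).
  have sq j : (size (q j) <= D.+1)%N by apply: leqW; exact: leq_bigmax.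
  have HE j : ev2 x z1 (homog D (1 - P%:P * 'X) Q%:P (q j)) = ev x Q ^+ D * ev2 x z2 (q j).
    rewrite (@ev2_homog _ _ _ z2) ?sq ?ev2C //.
    by rewrite ev2_linear (sub1_mul Pz).
  apply: (mulfI (expf_neq0 D (ev_nz _ Q_nz))); rewrite mulr0 -HE.
  apply: (indm (fun j => homog D (1 - P%:P * 'X) Q%:P (q j))).
  under eq_bigr => j _ do rewrite HE -mulrA.
  by rewrite -mulr_sumr q0 mulr0.
have h2 : (d * (sizeY g2).-1 <= ht z2)%N.
  by apply: (ht_lowerY Ax Am indm2) => q sq; apply: minY2; rewrite -ltnS prednK in sq.
pose gh := homog k (1 - P%:P * 'X) Q%:P g2.
have gh0 : ev2 x z1 gh = 0.
  rewrite (@ev2_homog _ _ _ z2) ?g20 ?mulr0 ?kE2 //.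
  by rewrite ev2_linear ev2C (sub1_mul Pz).
(* Both sides are relations for [z1] of degree at most [k] with the same coefficient at [k], so
   minimality makes the difference vanish. *)
have prop : g1`_k *: gh = (g2`_k * (- P) ^+ k) *: g1.
  apply/eqP; rewrite -subr_eq0; apply/eqP/min1; last first.
    by rewrite ev2B !ev2Z gh0 g10 !mulr0 subr0.
  rewrite -kE ltnS; apply/leq_sizeP => j; rewrite leq_eqVlt => /predU1P[<-|ltj].
    by rewrite coefB !coefZ coef_homog_lead mulrC subrr.
  have sg1 : (size g1 <= j)%N by rewrite -kE.
  rewrite coefB !coefZ (nth_default 0 (leq_trans (size_homog _ _ _ _) ltj)).
  by rewrite (nth_default 0 sg1) !mulr0 subr0.
pose w := - ev x a / ev x c.
have cx := ev_nz _ c_nz; have Qx := ev_nz _ Q_nz.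
have wE : ev x (- a) = w * ev x c by rewrite evN /w divfK.
have bE : b * Q = - c - a * P.
  by apply/eqP; rewrite -subr_eq0 opprD !opprK [c + _]addrC addrA [b * Q + _]addrC abc0.
have w2E : ev x (- b) = ((1 - ev x P * w) / ev x Q) * ev x c.
  have := congr1 (ev x) bE; rewrite evM evB evN evM => bEx.
  apply: (mulIf Qx); rewrite evN mulNr bEx [RHS]mulrAC divfK // mulrBl mul1r.
  by rewrite -mulrA -wE evN mulrN opprB !opprK addrC [ev x a * _]mulrC.
have key : g1`_k * Q ^+ k * homogC k (- b) c g2 = g2`_k * (- P) ^+ k * homogC k (- a) c g1.
  apply/eqP; rewrite -subr_eq0; apply/eqP/tx; apply/eqP; rewrite evB subr_eq0; apply/eqP.
  have := congr1 (ev2 x w) prop; rewrite !ev2Z.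
  rewrite (@ev2_homog _ _ _ ((1 - ev x P * w) / ev x Q)) ?kE2 //; last first.
    by rewrite ev2_linear ev2C divfK.
  rewrite ev2C => eqw.
  rewrite evM [ev x (_ * Q ^+ k)]evM [RHS]evM (ev_homogC _ w2E) ?kE2 //.
  by rewrite (ev_homogC _ wE) ?kE // mulrCA -mulrA evXn eqw mulrCA.
(* Otherwise [c X + a] divides [g1] up to a scalar; as it does not vanish at [z1], the quotient
   would be a smaller relation for [z1]. *)
have gw_nz : ev2 x w g1 != 0.
  apply/eqP => gw0; pose l := c *: 'X + a%:P.
  have sl : size l = 2.
    rewrite /l -mul_polyC size_MXaddC polyC_eq0 (negPf c_nz) size_polyC c_nz //.
  have evl y : ev2 x y l = ev x c * y + ev x a.
    by rewrite ev2D ev2Z ev2X ev2C.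
  have de := Pdiv.Idomain.divp_eq g1 l.
  have rE : g1 %% l = ((g1 %% l)`_0)%:P.
    by apply: size1_polyC; have := ltn_modp g1 l; rewrite -size_poly_eq0 sl ltnS.
  have lw : ev2 x w l = 0 by rewrite evl /w mulrC divfK // addNr.
  have r0 : g1 %% l = 0.
    rewrite rE; have := congr1 (ev2 x w) de.
    rewrite ev2Z gw0 mulr0 ev2D ev2M lw mulr0 add0r rE ev2C coefC eqxx.
    by move/esym/tx => ->.
  have l1 : ev2 x z1 l != 0 by rewrite evl.
  have q0 : g1 %/ l = 0.
    apply: min1.
      by rewrite size_divp -?size_poly_eq0 ?sl // -{2}(subnK s1) addn1 ltnS.
    have := congr1 (ev2 x z1) de.
    rewrite ev2Z g10 mulr0 r0 addr0 ev2M => /esym/eqP.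
    by rewrite mulf_eq0 (negPf l1) orbF => /eqP.
  move: de; rewrite q0 r0 mul0r addr0 => /eqP.
  by rewrite scale_poly_eq0 expf_eq0 lead_coef_eq0 -[l == 0]size_poly_eq0 sl andbF (negPf g1_nz).
have H1_nz : homogC k (- a) c g1 != 0.
  apply: contraNneq gw_nz => h0; have := ev_homogC (eq_leq (esym kE)) wE.
  rewrite h0 ev0 => /esym/eqP.
  by rewrite mulf_eq0 expf_eq0 (negPf cx) andbF.
have g2k_nz : g2`_k != 0 by rewrite /k -sE lead_coef_eq0.
(* [Q ^ k] divides the right side of [key] and is prime to the power of [P] there. *)
have dvdQ : Q ^+ k %| g2`_k * homogC k (- a) c g1.
  rewrite -(Gauss_dvdpr _ (_ : coprimep (Q ^+ k) (P ^+ k))); last first.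
    by rewrite coprimep_expl // coprimep_expr.
  apply/dvdpP; exists ((-1) ^+ k * (g1`_k * homogC k (- b) c g2)).
  rewrite -mulrA [g1`_k * _ * _]mulrAC key [g2`_k * (- P) ^+ k]mulrC -!mulrA [RHS]mulrA.
  by rewrite -exprMn mulN1r opprK.
have sizeX (q : {poly E}) j : (size q <= N.+1)%N -> (size (q ^+ j)%R <= (N * j).+1)%N.
  move=> sq; apply: leq_trans (size_poly_exp_leq _ _) _; rewrite ltnS leq_mul2r.
  by rewrite -subn1 leq_subLR add1n sq orbT.
have sH1 : (size (homogC k (- a) c g1) <= ((sizeY g1).-1 + N * k).+1)%N.
  apply: (leq_trans (size_sum _ _ _)); apply/bigmax_leqP => j _.
  have -> : (N * k = N * j + N * (k - j))%N by rewrite -mulnDr subnKC // -ltnS.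
  rewrite addnA; apply: size_mul_le; last exact: sizeX.
  apply: size_mul_le; first by rewrite prednK // max_size_coefXY.
  by apply: sizeX; rewrite size_polyN.
have main : ((n - N) * k <= (sizeY g1).-1 + (sizeY g2).-1)%N.
  have sg2 : (size (g2`_k)%R <= (sizeY g2).-1.+1)%N by rewrite prednK // max_size_coefXY.
  have := leq_trans (dvdp_leq (mulf_neq0 g2k_nz H1_nz) dvdQ) (size_mul_le sg2 sH1).
  have := size_exp Q k; rewrite sQ /= mulnBl => <- le; rewrite leq_subLR.
  by rewrite [X in (_ <= X)%N]addnC -addnA addnCA -subn1 leq_subLR add1n.
apply: leq_trans (leq_add h1 h2); rewrite -mulnDr.
by apply: leq_trans (leq_mul (leqnn _) hx) _; rewrite mulnCA leq_mul2l main orbT.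
Qed.

End Heights.

(** * Subfields and rational functions *)

(* The closure proofs are bundled with the set so that the field structure on
   [subf S] can be inferred from [S]. *)
Record subfield_set (K : fieldType) := SubfieldSet {
  sset :> K -> Prop;
  sset1 : sset 1;
  ssetB : forall u v, sset u -> sset v -> sset (u - v);
  sset_div : forall u v, sset u -> sset v -> sset (u / v) }.

Section SubField.
Variables (K : fieldType) (S : subfield_set K).

Definition subf_pred : {pred K} := fun u => `[< S u >].
Fact subf_pred_closed : divring_closed subf_pred.
Proof.
split=> [|u v /asboolP Su /asboolP Sv|u v /asboolP Su /asboolP Sv]; apply/asboolP.
- exact: sset1.
- exact: ssetB.
- exact: sset_div.
Qed.
HB.instance Definition _ := GRing.isDivringClosed.Build K subf_pred subf_pred_closed.
Record subf := Subf { subf_val :> K; subf_valP : subf_val \in subf_pred }.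
HB.instance Definition _ := [isSub for subf_val].
HB.instance Definition _ := [Choice of subf by <:].
HB.instance Definition _ := [SubChoice_isSubIntegralDomain of subf by <:].
HB.instance Definition _ := [SubIntegralDomain_isSubField of subf by <:].

End SubField.

Lemma subfield_type (K : fieldType) (S : K -> Prop) : S 1 ->
  (forall u v, S u -> S v -> S (u - v)) -> (forall u v, S u -> S v -> S (u / v)) ->
  exists (E : fieldType) (iota : {rmorphism E -> K}), forall u, S u <-> exists e, iota e = u.
Proof.
move=> S1 SB SD; pose T := SubfieldSet S1 SB SD.
exists (subf T), (val : {rmorphism subf T -> K}) => u.
split=> [Su|[e <-]]; last by apply/asboolP; exact: (valP e).
by exists (@Subf _ T u (introT (asboolP _) Su)).
Qed.

Section RationalFunctions.
Variables (E K : fieldType) (iota : {rmorphism E -> K}).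
Local Notation ev := (ev iota).
Local Notation ev2 := (ev2 iota).
Local Notation transc := (transc iota).

Definition ratfun x u := exists p q, ev x q != 0 /\ ev x q * u = ev x p.

Lemma ratfun_ev x p : ratfun x (ev x p).
Proof. by exists p, 1; rewrite ev1 oner_neq0 mul1r. Qed.

Lemma ratfunB x u v : ratfun x u -> ratfun x v -> ratfun x (u - v).
Proof.
move=> [p [q [q_nz pE]]] [p' [q' [q'_nz p'E]]].
exists (p * q' - p' * q), (q * q'); rewrite !(evM, evB) mulf_neq0 //; split=> //.
by rewrite mulrBr -pE -p'E; congr (_ - _); rewrite ?[ev x q' * v * _]mulrC -?mulrA //; congr (_ * _); rewrite mulrC.
Qed.

Lemma ratfun_div x u v : ratfun x u -> ratfun x v -> ratfun x (u / v).
Proof.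
move=> [p [q [q_nz pE]]] [p' [q' [q'_nz p'E]]].
have [->|v_nz] := eqVneq v 0.
  by rewrite invr0 mulr0; exists 0, 1; rewrite ev1 ev0 oner_neq0 mulr0.
have p'_nz : ev x p' != 0 by rewrite -p'E mulf_neq0.
exists (p * q'), (q * p'); rewrite !evM mulf_neq0 //; split=> //.
by rewrite -pE -p'E; field.
Qed.

Lemma ratfun_field x : exists (F : fieldType) (jj : {rmorphism F -> K}),
  forall u, ratfun x u <-> exists e, jj e = u.
Proof.
apply: subfield_type; [|exact: ratfunB|exact: ratfun_div].
by rewrite -(ev1 iota x); exact: ratfun_ev.
Qed.

Lemma clear_denominators x (I : finType) (u : I -> K) : (forall i, ratfun x (u i)) ->
  exists q, ev x q != 0 /\ exists p : I -> {poly E}, forall i, ev x (p i) = ev x q * u i.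
Proof.
move=> /choice[p /choice[q qP]].
exists (\prod_i q i); split.
  by rewrite rmorph_prod; apply/prodf_neq0 => i _; case: (qP i).
exists (fun i => p i * \prod_(j | j != i) q j) => i.
by rewrite [in RHS](bigD1 i) //= !evM; case: (qP i) => _ <-; rewrite mulrAC.
Qed.

Variables (x : K) (F : fieldType) (jj : {rmorphism F -> K}).
Hypothesis jjP : forall u, ratfun x u <-> exists e, jj e = u.

Lemma ratfun_lift : exists2 l : {poly E} -> F, forall p, jj (l p) = ev x p & l 0 = 0.
Proof.
have /choice[l lP] p : exists e, jj e = ev x p by apply/jjP/ratfun_ev.
by exists l => //; apply: (fmorph_inj jj); rewrite lP ev0 rmorph0.
Qed.

Lemma ratfun_alg z : transc x ->
  algebraicOver jj z <-> exists2 f, f != 0 & ev2 x z f = 0.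
Proof.
move=> tx; split=> [[c c_nz /eqP cz]|[f f_nz fz]].
  have /clear_denominators[q [q_nz [p pP]]] (i : 'I_(size c)) : ratfun x (jj c`_i).
    by apply/jjP; exists c`_i.
  pose f := \poly_(i < size c) (if insub i is Some i' then p i' else 0).
  have fE (i : 'I_(size c)) : f`_i = p i.
    by rewrite coef_poly ltn_ord insubT //= => lt; congr p; apply/val_inj.
  exists f.
    have sc : (0 < size c)%N by rewrite size_poly_gt0.
    have ltc : ((size c).-1 < size c)%N by rewrite prednK.
    apply: contraNneq c_nz => f0; have := pP (Ordinal ltc).
    rewrite -fE f0 coef0 ev0 => /esym/eqP; rewrite mulf_eq0 (negPf q_nz) fmorph_eq0 /=.
    by rewrite lead_coef_eq0.
  have cz' : ev x q * (map_poly jj c).[z] = 0 by rewrite cz mulr0.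
  rewrite (ev2_sum _ _ _ (size_poly _ _)) -[RHS]cz' horner_coef size_map_poly mulr_sumr; apply: eq_bigr => i _; rewrite fE pP coef_map mulrA //.
have [l lP l0] := ratfun_lift.
pose c := \poly_(i < size f) l f`_i.
have cE i : jj c`_i = ev x f`_i.
  by rewrite coef_poly; case: ltnP => [_|/(nth_default _) ->]; rewrite ?lP // rmorph0 ev0.
exists c.
  apply: contraNneq f_nz => c0; apply/eqP/polyP => i; rewrite coef0; apply: tx.
  by rewrite -cE c0 coef0 rmorph0.
apply/eqP; rewrite (@horner_coef_wide _ (size f)) ?(leq_trans (size_map_poly _ _)).
  by rewrite -[RHS]fz (ev2_sum _ _ _ (leqnn _)); apply: eq_bigr => i _; rewrite coef_map /= cE.
by rewrite size_map_poly size_poly.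
Qed.

Lemma ratfun_alg_trans t z : transc x -> transc t ->
  algebraicOver jj t -> (exists2 f, f != 0 & ev2 t z f = 0) -> algebraicOver jj z.
Proof.
move=> tx tt algt [f f_nz fz]; have [l lP l0] := ratfun_lift.
apply: algebraic_root_polyXY algt.
pose c := \poly_(i < sizeY f) \poly_(j < size f) l (f`_j`_i)%:P.
have cE i j : jj c`_i`_j = iota f`_j`_i.
  rewrite coef_poly; case: ltnP => [_|gei]; last first.
    by rewrite coef0 rmorph0 nth_default ?rmorph0 // (leq_trans (max_size_coefXY _ _)).
  rewrite coef_poly; case: ltnP => [_|/(nth_default _) ->]; first by rewrite lP evC.
  by rewrite coef0 !rmorph0.
have pE : (map_poly (map_poly jj) c).[t%:P] = map_poly (ev t) f.
  rewrite (@horner_coef_wide _ (sizeY f)); last first.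
    by apply: leq_trans (size_poly _ _) _; apply: size_poly.
  apply/polyP => j; rewrite coef_sum coef_map /=.
  rewrite (ev_sum _ _ (max_size_coefXY f j)); apply: eq_bigr => i _.
  by rewrite -polyC_exp coefMC !coef_map /= cE.
exists c; rewrite pE; last by apply/eqP.
apply: contraNneq f_nz => f0; apply/eqP/polyP => j; rewrite coef0; apply: tt.
by have := congr1 (fun p : {poly K} => p`_j) f0; rewrite coef_map coef0.
Qed.

End RationalFunctions.

(** Exchange: a relation between [t] and [x] makes [t] algebraic over E(x), and [z] is algebraic
    over E(t). *)
Lemma dep_trans (E K : fieldType) (iota : {rmorphism E -> K}) t x z :
  transc iota t -> transc iota x ->
  (forall g, exists2 f, f != 0 & ev2 iota t g f = 0) ->
  exists2 f, f != 0 & ev2 iota x z f = 0.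
Proof.
move=> tt tx dept; have [F [jj jjP]] := ratfun_field iota x.
apply/(ratfun_alg jjP _ tx)/(ratfun_alg_trans jjP tx tt); last exact: dept.
apply/(ratfun_alg jjP _ tx); have [f f_nz fx] := dept x.
by exists (swapXY f); rewrite ?swapXY_eq0 // ev2_swap.
Qed.

(** * A subfield over which K has transcendence degree one *)

Section MaximalSubfield.
Local Open Scope classical_set_scope.
Variables (K : fieldType) (t : K).

Definition subfield_closed (S : set K) := [/\ S 1,
  forall u v, S u -> S v -> S (u - v) & forall u v, S u -> S v -> S (u / v)].
Definition transc_over (S : set K) :=
  forall q : {poly K}, (forall i, S q`_i) -> q.[t] = 0 -> q = 0.

Lemma maximal_transc_subfield (S0 : set K) : subfield_closed S0 -> transc_over S0 ->
  exists A : set K, [/\ subfield_closed A, transc_over A &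
    forall B, subfield_closed B -> transc_over B -> A `<=` B -> B `<=` A].
Proof.
move=> clS0 trS0; pose P (S : set K) := S = set0 \/ (subfield_closed S /\ transc_over S).
have [|A [PA maxA]] := @Zorn_bigcup K P.
  move=> F FP totF; have [->|/set0P[u0 [X0 FX0 X0u0]]] := eqVneq (\bigcup_(X in F) X) set0.
    by left.
  have clX X u : F X -> X u -> subfield_closed X /\ transc_over X.
    by move=> /FP [->|].
  have join X Y : F X -> F Y -> exists Z, [/\ F Z, X `<=` Z & Y `<=` Z].
    by move=> FX FY; have [XY|YX] := totF _ _ FX FY; [exists Y|exists X]; split.
  right; split; first split.
  - by exists X0 => //; have [[]] := clX _ _ FX0 X0u0.
  - move=> u v [X FX Xu] [Y FY Yv]; have [Z [FZ XZ YZ]] := join _ _ FX FY.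
    exists Z => //; have [[_ ZB _] _] := clX _ _ FZ (XZ _ Xu).
    by apply: ZB; [apply: XZ|apply: YZ].
  - move=> u v [X FX Xu] [Y FY Yv]; have [Z [FZ XZ YZ]] := join _ _ FX FY.
    exists Z => //; have [[_ _ ZD] _] := clX _ _ FZ (XZ _ Xu).
    by apply: ZD; [apply: XZ|apply: YZ].
  move=> q qU q0.
  have [X [FX X0X qX]] : exists X, [/\ F X, X0 `<=` X & forall i, (i < size q)%N -> X q`_i].
    elim: (size q) => [|n [X [FX X0X qX]]]; first by exists X0; split.
    have [Y FY Yq] := qU n; have [Z [FZ XZ YZ]] := join _ _ FX FY.
    exists Z; split=> // [u /X0X/XZ//|i]; rewrite ltnS leq_eqVlt => /predU1P[->|/qX/XZ//].
    exact: YZ.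
  have [clX' trX] := clX _ _ FX (X0X _ X0u0).
  apply: trX => // i; case: (ltnP i (size q)) => [/qX//|/(nth_default _) ->].
  by case: clX' => X1 XB _; rewrite -(subrr 1); apply: XB.
have A_nz : A <> set0.
  move=> A0; apply: (maxA S0); last by right.
  rewrite A0 properEneq; split; last exact: sub0set.
  by apply/eqP => S0e; case: clS0; rewrite -S0e.
case: PA => [//|[clA trA]]; exists A; split=> // B clB trB AB.
by apply: contrapT => nBA; apply: (maxA B); [split | right].
Qed.

End MaximalSubfield.

(** If [g] and [t] were independent over the maximal subfield, [t] would remain transcendental over
    the larger subfield generated by [g]. *)
Lemma exists_one_dim_subfield (K : fieldType) (t : K) (S0 : set K) :
  subfield_closed S0 -> transc_over t S0 ->
  exists (E : fieldType) (iota : {rmorphism E -> K}),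
    transc iota t /\ forall g, exists2 f, f != 0 & ev2 iota t g f = 0.
Proof.
move=> clS0 trS0; have [A [[A1 AB AD] trA maxA]] := maximal_transc_subfield clS0 trS0.
have [E [iota iotaP]] := subfield_type A1 AB AD; exists E, iota.
have tt : transc iota t.
  move=> c ct; apply/(map_poly_inj iota); rewrite rmorph0; apply: trA => // i.
  by rewrite coef_map; apply/iotaP; exists c`_i.
split=> // g; apply: contrapT => nof.
have nA : ~ A g.
  move=> /iotaP[e eg]; apply: nof; exists ('X - e%:P%:P); first by rewrite -size_poly_eq0 size_XsubC.
  by rewrite ev2B ev2X ev2C evC eg subrr.
apply/nA/(maxA (ratfun iota g)).
- split; [|exact: ratfunB|exact: ratfun_div].
  by rewrite -(ev1 iota g); exact: ratfun_ev.
- move=> q qR q0; have [Q [Q_nz [p pP]]] := clear_denominators (fun i : 'I_(size q) => qR i).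
  pose f := \poly_(i < size q) (if insub i is Some i' then p i' else 0).
  have fE (i : 'I_(size q)) : f`_i = p i.
    by rewrite coef_poly ltn_ord insubT //= => lt; congr p; apply/val_inj.
  have fgt : ev2 iota g t f = 0.
    have q0' : ev iota g Q * q.[t] = 0 by rewrite q0 mulr0.
    rewrite (ev2_sum _ _ _ (size_poly _ _)) -[RHS]q0' horner_coef mulr_sumr.
    by apply: eq_bigr => i _; rewrite fE pP mulrA.
  have f0 : f = 0.
    apply/eqP; rewrite -swapXY_eq0; apply/negPn/negP => fn; apply: nof.
    by exists (swapXY f); rewrite ?ev2_swap.
  apply/polyP => i; rewrite coef0.
  case: (ltnP i (size q)) => [lti|/(nth_default _) -> //].
  have := pP (Ordinal lti); rewrite -fE f0 coef0 ev0 => /esym/eqP.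
  by rewrite mulf_eq0 (negPf Q_nz) => /eqP.
- by move=> u /iotaP[e <-]; rewrite -(evC iota g e); exact: ratfun_ev.
- by rewrite -{2}(evX iota g); exact: ratfun_ev.
Qed.

(** * Finitely generated monoids have finite rank *)

Definition mgen (K : fieldType) (l : seq K) (u : K) :=
  exists2 s : seq K, {subset s <= l} & u = \prod_(a <- s) a.

Lemma mgen1 (K : fieldType) (l : seq K) : mgen l 1.
Proof. by exists [::]; rewrite ?big_nil. Qed.

Lemma mgenM (K : fieldType) (l : seq K) u v : mgen l u -> mgen l v -> mgen l (u * v).
Proof.
move=> [s sl ->] [s' s'l ->]; exists (s ++ s'); rewrite ?big_cat // => a.
by rewrite mem_cat => /orP[/sl|/s'l].
Qed.

Lemma mgen_mem (K : fieldType) (l : seq K) u : u \in l -> mgen l u.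
Proof. by move=> ul; exists [:: u]; rewrite ?big_seq1 // => a; rewrite inE => /eqP ->. Qed.

Section FiniteSpan.
Variables (F K : fieldType) (jj : {rmorphism F -> K}).

Definition spanned (I : finType) (m : I -> K) u :=
  exists c : I -> F, u = \sum_k jj (c k) * m k.

Lemma spanned_sum (I J : finType) (m : I -> K) (e : J -> F) u :
  (forall j, spanned m (u j)) -> spanned m (\sum_j jj (e j) * u j).
Proof.
move=> /choice[c cP]; exists (fun k => \sum_j e j * c j k).
under eq_bigr => j _ do rewrite cP mulr_sumr.
rewrite exchange_big; apply: eq_bigr => k _ /=; rewrite rmorph_sum mulr_suml.
by apply: eq_bigr => j _; rewrite rmorphM mulrA.
Qed.

Lemma spanned_basis (I : finType) (m : I -> K) k : spanned m (m k).
Proof.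
exists (fun j => (j == k)%:R); rewrite (bigD1 k) //= eqxx rmorph1 mul1r big1 ?addr0 //.
by move=> j /negPf ->; rewrite rmorph0 mul0r.
Qed.

(** Adjoin the elements one at a time: a root [g] of a monic polynomial of degree [D] replaces the
    family by its products with the powers of [g] below [D]. *)
Lemma finite_span (l : seq K) : (forall a, a \in l -> algebraicOver jj a) ->
  exists (I : finType) (m : I -> K),
    spanned m 1 /\ forall a, a \in l -> forall k, spanned m (a * m k).
Proof.
elim: l => [|g l IH] algl.
  exists unit, (fun=> 1); split=> //; exact: (spanned_basis _ tt).
have [a al|I [m [m1 ml]]] := IH; first by apply: algl; rewrite inE al orbT.
have /integral_algebraic[c c_mon /eqP cg] : algebraicOver jj g.
  by apply: algl; rewrite inE eqxx.
pose D := (size c).-1.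
have sc : size c = D.+1 by rewrite prednK // size_poly_gt0 monic_neq0.
have D_gt0 : (0 < D)%N.
  rewrite lt0n; apply/eqP => D0; move: cg c_mon; rewrite D0 in sc.
  have /eqP/size_poly1P[e e_nz ->] := sc; rewrite map_polyC hornerC => /eqP.
  by rewrite fmorph_eq0 (negPf e_nz).
pose m' (p : 'I_D * I) := g ^+ p.1 * m p.2.
have m'b j k : spanned m' (g ^+ (nat_of_ord j) * m k) := spanned_basis m' (j, k).
exists ('I_D * I)%type, m'; split.
  case: m1 => e ->; apply: spanned_sum => k.
  by have := m'b (Ordinal D_gt0) k; rewrite expr0 mul1r.
move=> a; rewrite inE => /predU1P[->|al] [j k]; last first.
  have [e eE] := ml a al k; rewrite /m' mulrCA eE mulr_sumr.
  by under eq_bigr => k' _ do rewrite mulrCA; apply: spanned_sum => k'.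
rewrite /m' mulrA -exprS /=; have [lt|ge] := ltnP j.+1 D; first exact: (m'b (Ordinal lt)).
have -> : j.+1 = D by apply/eqP; rewrite eqn_leq ge ltn_ord.
have -> : g ^+ D = \sum_(i < D) jj (- c`_i) * g ^+ i.
  move: cg; rewrite horner_coef size_map_poly sc big_ord_recr /= coef_map /=.
  have -> : c`_D = 1 by move/monicP: c_mon; rewrite /lead_coef sc.
  rewrite rmorph1 mul1r addrC => /eqP; rewrite addr_eq0 => /eqP ->.
  by rewrite -sumrN; apply: eq_bigr => i _; rewrite coef_map rmorphN mulNr.
rewrite mulr_suml; under eq_bigr => i _ do rewrite -mulrA.
by apply: spanned_sum => i.
Qed.

Lemma spanned_mgen (l : seq K) (I : finType) (m : I -> K) u : spanned m 1 ->
  (forall a, a \in l -> forall k, spanned m (a * m k)) -> mgen l u -> spanned m u.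
Proof.
move=> m1 ml [s + ->]; elim: s => [|a s IH] sl; first by rewrite big_nil.
rewrite big_cons; have [|c ->] := IH.
  by move=> b bs; apply: sl; rewrite inE bs orbT.
rewrite mulr_sumr; under eq_bigr => k _ do rewrite mulrCA.
by apply: spanned_sum => k; apply: ml; apply: sl; rewrite inE eqxx.
Qed.

End FiniteSpan.

(** All of [l] is algebraic over E(x), so the monoid lies in a finite-dimensional space over
    E(x). *)
Lemma bounded_mgen (E K : fieldType) (iota : {rmorphism E -> K}) (l : seq K) x :
  transc iota x -> (forall z, exists2 f, f != 0 & ev2 iota x z f = 0) ->
  exists n, forall R (m : 'I_R -> K),
    (forall i, mgen l (m i)) -> ind iota x m -> (R <= n)%N.
Proof.
move=> tx depx; have [F [jj jjP]] := ratfun_field iota x.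
have [a _|I [b [b1 bl]]] := @finite_span _ _ jj l; first exact/(ratfun_alg jjP _ tx).
exists #|I| => R m lm indm; rewrite leqNgt; apply/negP => ltR.
have /choice[c cP] i : spanned jj b (m i) := spanned_mgen b1 bl (lm i).
have [|e [i0 ei0] e0] := lin_dep c; first by rewrite card_ord.
have [i|q [q_nz [p pP]]] := @clear_denominators _ _ iota x _ (fun i => jj (e i)).
  by apply/jjP; exists (e i).
have p0 : p i0 = 0.
  apply: (indm p); under eq_bigr => i _ do rewrite pP -mulrA.
  rewrite -mulr_sumr; have -> : \sum_i jj (e i) * m i = 0; last by rewrite mulr0.
  under eq_bigr => i _ do rewrite cP mulr_sumr.
  rewrite exchange_big big1 // => k _ /=; under eq_bigr => i _ do rewrite mulrA -rmorphM.
  by rewrite -mulr_suml -rmorph_sum e0 rmorph0 mul0r.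
have /esym/eqP := pP i0; rewrite p0 ev0 mulf_eq0 (negPf q_nz) fmorph_eq0 /=.
by rewrite (negPf ei0).
Qed.

(** * Pade approximation of (1 - X)^m over F_p *)

Section PrimeField.
Variables (p : nat) (R : fieldType) (pcharR : p \in [pchar R]).

(* [pcharR] is kept as a dependency: it carries the ring morphism structure. *)
Definition fp (a : 'F_p) : R := let _ := pcharR in (nat_of_ord a)%:R.

Let natrFp n : (inZp n : 'F_p)%:R = n%:R :> R.
Proof. by rewrite /= (Fp_cast (pcharf_prime pcharR)) GRing.natr_mod_pchar. Qed.

Fact fp_is_zmod_morphism : zmod_morphism fp.
Proof.
have fpD a b : fp (a + b) = fp a + fp b by rewrite /fp [LHS]natrFp natrD.
have fp0 : fp 0 = 0 by [].
by move=> a b; apply: (addIr (fp b)); rewrite -fpD !subrK.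
Qed.
Fact fp_is_monoid_morphism : monoid_morphism fp.
Proof.
split=> [|a b]; first by rewrite /fp /= (Fp_cast (pcharf_prime pcharR)) GRing.natr_mod_pchar.
by rewrite /fp [LHS]natrFp natrM.
Qed.
HB.instance Definition _ := GRing.isZmodMorphism.Build 'F_p R fp fp_is_zmod_morphism.
HB.instance Definition _ := GRing.isMonoidMorphism.Build 'F_p R fp fp_is_monoid_morphism.

Lemma fp_frobenius a : fp a ^+ p = fp a.
Proof. by rewrite -(pFrobenius_autE pcharR) /fp pFrobenius_aut_nat. Qed.

Lemma ev_frobenius x (q : {poly 'F_p}) : ev fp x q ^+ p = ev fp (x ^+ p) q.
Proof.
rewrite !(ev_sum _ _ (leqnn _)) -(pFrobenius_autE pcharR) rmorph_sum; apply: eq_bigr => i _.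
by rewrite /= !pFrobenius_autE exprMn fp_frobenius exprAC.
Qed.

End PrimeField.

Section Pade.
Variable k : fieldType.

Lemma pade_coprime m : coprimep ((1 - 'X) ^+ m) ('X^m : {poly k}).
Proof.
rewrite coprimep_expl // coprimep_expr //; apply/Bezout_coprimepP; exists (1, 1).
by rewrite !mul1r subrK eqpxx.
Qed.

Lemma size_sub1X_exp m : size ((1 - 'X) ^+ m : {poly k}) = m.+1.
Proof.
have -> : 1 - 'X = (-1) *: ('X - 1%:P) :> {poly k} by rewrite scaleN1r opprB.
by rewrite exprZn size_scale ?size_exp_XsubC // expf_neq0 // oppr_eq0 oner_eq0.
Qed.

Lemma pade_trivial m n (a b : {poly k}) : (n < m)%N -> (size b <= n.+1)%N ->
  a * 'X^m + b * (1 - 'X) ^+ m = 0 -> a = 0 /\ b = 0.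
Proof.
move=> ltnm sb ab0.
have Xb : 'X^m %| b.
  rewrite -(Gauss_dvdpl _ (_ : coprimep 'X^m ((1 - 'X) ^+ m))).
    by rewrite -[b * _](addKr (a * 'X^m)) ab0 addr0 -mulNr dvdp_mull.
  by rewrite coprimep_sym pade_coprime.
have b0 : b = 0.
  apply/eqP/negPn/negP => b_nz; have := dvdp_leq b_nz Xb; rewrite size_polyXn => lt.
  by have := leq_trans lt sb; rewrite ltnS leqNgt ltnm.
split=> //; move/eqP: ab0; rewrite b0 mul0r addr0 mulf_eq0 expf_eq0 polyX_eq0 andbF orbF.
by move/eqP.
Qed.

(** There are [3 * N.+1] unknown coefficients and only [3 * N + 2] equations. If [c] were zero,
    [pade_trivial] would make the solution trivial. *)
Lemma pade_exists N : exists a b c : {poly k},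
  [/\ (size a <= N.+1)%N, (size b <= N.+1)%N, (size c <= N.+1)%N, c != 0 &
      a * 'X^(N.*2.+1) + b * (1 - 'X) ^+ N.*2.+1 + c = 0].
Proof.
pose m := N.*2.+1.
pose base (s : 'I_3) : {poly k} := tnth [tuple 'X^m; (1 - 'X) ^+ m; 1] s.
have szb s : (size (base s) <= m.+1)%N.
  by case: s => [[|[|[|s]]]] //= lt; rewrite /base (tnth_nth 0) /=
    ?size_polyXn ?size_sub1X_exp ?size_poly1.
pose phi (h : 'I_3 * 'I_N.+1) (j : 'I_(m + N).+1) := ('X^(h.2) * base h.1)`_j.
have [|e [h0 eh0] e0] := lin_dep phi.
  by rewrite card_prod !card_ord /m -addnn; lia.
pose q s : {poly k} := \poly_(i < N.+1) (if insub i is Some i' then e (s, i') else 0).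
have qE s (i : 'I_N.+1) : (q s)`_i = e (s, i).
  by rewrite coef_poly ltn_ord insubT //= => lt; congr (e (_, _)); apply/val_inj.
have qsum s : q s = \sum_(i < N.+1) (e (s, i))%:P * 'X^i.
  rewrite [LHS]poly_def; apply: eq_bigr => i _; rewrite mul_polyC; congr (_ *: _).
  by rewrite -qE coef_poly ltn_ord.
have szq s : (size (q s) <= N.+1)%N by exact: size_poly.
have rel : \sum_s q s * base s = 0.
  apply/polyP => j; rewrite coef0; case: (ltnP j (m + N).+1) => [ltj|gej].
    rewrite -[RHS](e0 (Ordinal ltj)) sum_pair coef_sum; apply: eq_bigr => s _.
    rewrite qsum mulr_suml coef_sum; apply: eq_bigr => i _.
    by rewrite -mulrA coefCM.
  apply: nth_default; apply: leq_trans gej; apply: (leq_trans (size_sum _ _ _)).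
  apply/bigmax_leqP => s _; rewrite addnC; exact: size_mul_le.
have {}rel : q ord0 * 'X^m + q (lift ord0 ord0) * (1 - 'X) ^+ m + q ord_max = 0.
  rewrite -[RHS]rel !big_ord_recl big_ord0 addr0 /base !(tnth_nth 0) /= mulr1 addrA.
  by congr (_ + q _); apply/val_inj.
exists (q ord0), (q (lift ord0 ord0)), (q ord_max); split=> //.
apply: contraNneq eh0 => c0; rewrite c0 addr0 in rel.
have [|a0 b0] := @pade_trivial m N _ _ _ (szq _) rel; first by rewrite /m -addnn; lia.
case: h0 => s i; rewrite -qE; suff -> : q s = 0 by rewrite coef0.
case: s => [[|[|[|s]]]] // lt.
- by rewrite -[RHS]a0; congr q; apply/val_inj.
- by rewrite -[RHS]b0; congr q; apply/val_inj.
- by rewrite -[RHS]c0; congr q; apply/val_inj.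
Qed.

Lemma deriv_eq0_pchar p (v : {poly k}) : p \in [pchar k] -> v^`() = 0 ->
  exists w, v = w \Po 'X^p.
Proof.
move=> pk v0; have p_gt0 : (0 < p)%N by rewrite prime_gt0 // (pcharf_prime pk).
exists (\poly_(i < size v) v`_(i * p)); apply/polyP => i.
rewrite coef_comp_poly_Xn // coef_poly; case: ifP => [/dvdnP[j ->]|ndv].
  rewrite mulnK //; case: ltnP => // ge; rewrite nth_default //.
  by apply: leq_trans ge _; rewrite leq_pmulr.
case: i ndv => [|i ndv]; first by rewrite dvdn0.
have := congr1 (fun q : {poly k} => q`_i) v0; rewrite coef_deriv coef0 -mulr_natr => /eqP.
by rewrite mulf_eq0 -(dvdn_pcharf pk) ndv orbF => /eqP.
Qed.

Lemma mulX_derivXn m : 'X * ('X^m)^`() = m%:R * 'X^m :> {poly k}.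
Proof.
by rewrite derivXn; case: m => [|m]; rewrite ?mulr0n ?mulr0 ?mul0r // mulrnAr -exprS mulr_natl.
Qed.

Lemma mul_deriv_sub1X_exp m :
  (1 - 'X) * ((1 - 'X) ^+ m)^`() = - (m%:R * (1 - 'X) ^+ m) :> {poly k}.
Proof.
have d1 : (1 - 'X : {poly k})^`() = -1 by rewrite derivB -polyC1 derivC derivX sub0r.
rewrite deriv_exp d1; case: m => [|m]; rewrite ?mulr0n ?mulr0 ?mul0r ?oppr0 //.
by rewrite mulN1r mulNrn mulrN mulrnAr -exprS mulr_natl.
Qed.

(** Differentiating and multiplying by [X (1 - X)] restores the powers [X ^ m] and [(1 - X) ^ m].
    This gives a second relation of the same shape for the case where the first one is
    degenerate. *)
Lemma pade_deriv m (a b c : {poly k}) :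
  a * 'X^m + b * (1 - 'X) ^+ m + c = 0 ->
  ('X * (1 - 'X) * a^`() + m%:R * (1 - 'X) * a) * 'X^m +
  ('X * (1 - 'X) * b^`() - m%:R * 'X * b) * (1 - 'X) ^+ m + 'X * (1 - 'X) * c^`() = 0.
Proof.
have aux (R : comPzRingType) (X Y M a0 a1 b0 b1 c1 P P1 Q Q1 : R) :
    X * P1 = M * P -> Y * Q1 = - (M * Q) ->
    (X * Y * a1 + M * Y * a0) * P + (X * Y * b1 - M * X * b0) * Q + X * Y * c1 =
    X * Y * (a1 * P + a0 * P1 + (b1 * Q + b0 * Q1) + c1).
  move=> h1 h2.
  have -> : X * Y * (a1 * P + a0 * P1 + (b1 * Q + b0 * Q1) + c1) =
    X * Y * a1 * P + Y * a0 * (X * P1) + X * Y * b1 * Q + X * b0 * (Y * Q1) + X * Y * c1.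
    by ring.
  by rewrite h1 h2; ring.
move=> /(congr1 (@deriv k)); rewrite deriv0 !derivD !derivM => rel.
by rewrite (aux _ _ _ _ _ _ _ _ _ _ _ _ _ (mulX_derivXn m) (mul_deriv_sub1X_exp m)) rel mulr0.
Qed.

(* If the derivative of [X^m a / c] vanishes then [X^m a / c] is a function of [X^p]. *)
Lemma wronskian_pchar p m (a c : {poly k}) : p \in [pchar k] ->
  'X * (a^`() * c - a * c^`()) + m%:R * a * c = 0 ->
  exists w, 'X^m * a * c ^+ p.-1 = w \Po 'X^p.
Proof.
move=> pk rel; apply: deriv_eq0_pchar => //.
have p_gt1 : (1 < p)%N by rewrite prime_gt1 // (pcharf_prime pk).
have pE : p = p.-2.+2 by case: p p_gt1 {pk} => [|[|]].
pose u : {poly k} := 'X^m * a.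
have uc : u^`() * c - u * c^`() = 0.
  have aux (R : comPzRingType) (X P P1 M a0 a1 c0 c1 : R) : X * P1 = M * P ->
      X * ((P1 * a0 + P * a1) * c0 - P * a0 * c1) =
      P * (X * (a1 * c0 - a0 * c1) + M * a0 * c0).
    move=> h1; have -> : X * ((P1 * a0 + P * a1) * c0 - P * a0 * c1) =
      (X * P1) * a0 * c0 + X * P * a1 * c0 - X * P * a0 * c1 by ring.
    by rewrite h1; ring.
  apply: (@mulfI _ 'X); first by rewrite polyX_eq0.
  by rewrite mulr0 /u derivM (aux _ _ _ _ _ _ _ _ _ (mulX_derivXn m)) rel mulr0.
(* Up to the factor [c ^ p], of zero derivative, [u * c ^ p.-1] is [u / c]; since [p.-1] is -1 in
   [k], its derivative is a multiple of the Wronskian [uc]. *)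
have p1 : p.-1%:R = -1 :> {poly k}.
  apply/eqP; rewrite -subr_eq0 opprK -mulrSr prednK ?(ltnW p_gt1) //.
  by rewrite -polyC_natr (pcharf0 pk).
have {}p1 (q : {poly k}) : q *+ p.-1 = - q by rewrite -mulr_natl p1 mulN1r.
rewrite -/u derivM deriv_exp p1 pE /= exprS mulrN.
have -> : u^`() * (c * c ^+ p.-2) - u * (c^`() * c ^+ p.-2) =
  (u^`() * c - u * c^`()) * c ^+ p.-2 by rewrite mulrBl !mulrA.
by rewrite uc mul0r.
Qed.

End Pade.

(** * Heights *)

Section IsHeight.
Variables (p : nat) (K : fieldType) (pcharK : p \in [pchar K]).
Local Notation evp := (ev (fp pcharK)).

(** Everything is stated over F_p, so that heights coming from different subfields E can be
    added. *)
Record is_height (A : K -> Prop) (h : K -> nat) : Prop := IsHeight {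
  height_mul : forall x y, A x -> A y -> (h (x * y)%R <= h x + h y)%N;
  height_inv : forall x, h x^-1 = h x;
  height_sub1 : forall x, h (1 - x) = h x;
  height_exp : forall n x, A x -> (n * h x <= h (x ^+ n)%R)%N;
  height_key : forall x z1 z2 n N (P Q a b c : {poly 'F_p}),
    A x -> A z1 -> A z2 -> P != 0 -> coprimep Q P -> size Q = n.+1 ->
    (size a <= N.+1)%N -> (size c <= N.+1)%N ->
    a * P + b * Q + c = 0 -> c != 0 ->
    evp x P * z1 + evp x Q * z2 = 1 -> evp x c * z1 + evp x a != 0 ->
    ((n - N) * h x <= h z1 + h z2)%N;
  height_rational : forall x w (P Q : {poly 'F_p}),
    w * evp x Q = evp x P -> evp x Q != 0 -> ~ algebraicOver (fp pcharK) w ->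
    (h x <= h w)%N }.

Lemma is_height_sum (I : finType) (A : I -> K -> Prop) (h : I -> K -> nat) (B : K -> Prop) :
  (forall i x, B x -> A i x) -> (forall i, is_height (A i) (h i)) ->
  is_height B (fun x => \sum_i h i x)%N.
Proof.
move=> BA hh; split.
- move=> x y Bx By; rewrite -big_split leq_sum // => i _.
  by apply: (height_mul (hh i)); exact: BA.
- by move=> x; apply: eq_bigr => i _; exact: height_inv.
- by move=> x; apply: eq_bigr => i _; exact: height_sub1.
- move=> n x Bx; rewrite big_distrr leq_sum // => i _.
  by apply: (height_exp (hh i)); exact: BA.
- move=> x z1 z2 n N P Q a b c Bx B1 B2 P0 cop sQ sa sc rel c0 Pz nd.
  rewrite big_distrr -big_split leq_sum // => i _.
  exact: (height_key (hh i) (BA i _ Bx) (BA i _ B1) (BA i _ B2) P0 cop sQ sa sc rel).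
- move=> x w P Q wE Q0 nw; rewrite leq_sum // => i _.
  exact: (height_rational (hh i) wE Q0 nw).
Qed.

Lemma image_fp_closed : subfield_closed [set fp pcharK a | a in [set: 'F_p]].
Proof.
split; first by exists 1; rewrite ?rmorph1.
  by move=> u v [a _ <-] [b _ <-]; exists (a - b); rewrite ?rmorphB.
by move=> u v [a _ <-] [b _ <-]; exists (a / b); rewrite ?fmorph_div.
Qed.

Lemma image_fp_transc t : ~ algebraicOver (fp pcharK) t ->
  transc_over t [set fp pcharK a | a in [set: 'F_p]].
Proof.
move=> nalg q qS q0.
have /choice[l lP] (i : nat) : exists a, fp pcharK a = q`_i by case: (qS i) => a _ <-; exists a.
pose c := \poly_(i < size q) l i.
have qc : q = map_poly (fp pcharK) c.
  apply/polyP => i; rewrite coef_map coef_poly /=.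
  by case: ltnP => [_|/(nth_default _) ->]; [rewrite lP | rewrite rmorph0].
apply/eqP; apply: contrapT => /negP q_nz; apply: nalg; exists c.
  by apply: contraNneq q_nz => c0; rewrite qc c0 rmorph0.
by rewrite -qc; apply/eqP.
Qed.

Lemma height_exists (l : seq K) t : ~ algebraicOver (fp pcharK) t ->
  exists2 h, is_height (mgen l) h & (0 < h t)%N.
Proof.
move=> nalg.
have [E [iota [tt dept]]] := exists_one_dim_subfield image_fp_closed (image_fp_transc nalg).
have dep x z : transc iota x -> exists2 f, f != 0 & ev2 iota x z f = 0.
  by move=> tx; exact: dep_trans tt tx dept.
have bnd x : transc iota x -> exists n, forall R (m : 'I_R -> K),
    (forall i, mgen l (m i)) -> ind iota x m -> (R <= n)%N.
  by move=> tx; apply: bounded_mgen => // z; exact: dep.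
have A1 := mgen1 l; have AM := @mgenM _ l.
have pcharE : p \in [pchar E] by rewrite -(fmorph_pchar iota).
pose kap := fp pcharE.
have kapE a : iota (kap a) = fp pcharK a by rewrite rmorph_nat.
have evE x q : ev iota x (map_poly kap q) = evp x q.
  rewrite (ev_sum _ _ (size_poly _ _)) (ev_sum _ _ (leqnn _)).
  by apply: eq_bigr => i _; rewrite coef_map /= kapE.
exists (ht bnd); last exact: ht_gt0.
split.
- by move=> x y; exact: ht_mul.
- exact: ht_inv.
- exact: ht_sub1.
- by move=> n x; exact: ht_exp.
- move=> x z1 z2 n N P Q a b c Ax A1' A2 P0 cop sQ sa sc rel c0.
  rewrite -!evE => Pz nd.
  apply: (@ht_key _ _ iota _ A1 AM bnd dep x z1 z2 n N _ _ _ (map_poly kap b) _ Ax A1' A2 _ _ _ _ _ _ _ Pz nd).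
  + by rewrite map_poly_eq0.
  + by rewrite coprimep_map.
  + by rewrite size_map_poly.
  + by rewrite size_map_poly.
  + by rewrite size_map_poly.
  + by rewrite -!rmorphM -!rmorphD /= rel rmorph0.
  + by rewrite map_poly_eq0.
- move=> x w P Q wE Q0 nw; have [tw|/ntranscP algw] := pselect (transc iota w).
    by apply: (@ht_rational _ _ _ _ _ _ _ (map_poly kap P) (map_poly kap Q)); rewrite ?evE.
  have [algx|nx] := pselect (algebraicOver iota x); first by rewrite (ht_alg bnd algx).
  (* [x] is a root of [P - w Q], which is nonzero because [w] is not a quotient of elements of
     F_p. *)
  case: nx; apply: algebraic_root_polyXY algw.
  exists ((map_poly kap P)%:P - 'X * (map_poly kap Q)%:P); last first.
    rewrite rmorphB rmorphM /= !map_polyC map_polyX /= !hornerE /root !hornerE.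
    by rewrite -[X in X - _]/(ev iota x _) -[X in _ * X]/(ev iota x _) !evE wE subrr.
  apply/eqP => eq0; apply: nw.
  have Q_nz : Q != 0 by apply: contraNneq Q0 => ->; rewrite ev0.
  have := congr1 (fun q : {poly K} => q`_(size Q).-1) eq0.
  rewrite rmorphB rmorphM /= !map_polyC map_polyX /= !hornerE coefB coefCM !coef_map /= !kapE.
  rewrite coef0 => /eqP; rewrite subr_eq0 => /eqP wQ.
  have lQ : fp pcharK Q`_(size Q).-1 != 0 by rewrite fmorph_eq0 lead_coef_eq0.
  rewrite -[w](mulfK lQ) -wQ -fmorph_div; exact: algebraic_id.
Qed.
End IsHeight.

(** * Repulsion of solutions *)

Section PairInequality.
Variables (p : nat) (K : fieldType) (pcharK : p \in [pchar K]).
Local Notation evp := (ev (fp pcharK)).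
Local Notation alg := (algebraicOver (fp pcharK)).
Variables (A : K -> Prop) (h : K -> nat).
Hypothesis hh : is_height pcharK A h.

Let evX_exp x m : evp x 'X^m = x ^+ m. Proof. by rewrite evXn evX. Qed.
Let ev1X_exp x m : evp x ((1 - 'X) ^+ m) = (1 - x) ^+ m.
Proof. by rewrite evXn evB ev1 evX. Qed.

(** This is [height_key] for the identity [X + (1 - X) - 1 = 0], with exponent 1 and constant
    coefficients. *)
Lemma height_quotient x z1 z2 : A x -> A z1 -> A z2 ->
  x * z1 + (1 - x) * z2 = 1 -> z1 != 1 -> (h x <= h z1 + h z2)%N.
Proof.
move=> Ax A1 A2 rel z1_1.
have := @height_key _ _ _ _ _ hh x z1 z2 1 0 'X^1 ((1 - 'X) ^+ 1) 1 1 (-1) Ax A1 A2.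
rewrite subn0 mul1n; apply.
- by rewrite expr1 polyX_eq0.
- exact: pade_coprime.
- by rewrite size_sub1X_exp.
- by rewrite size_poly1.
- by rewrite size_polyN size_poly1.
- by rewrite !mul1r !expr1 [1 - 'X]addrC addrA subrr add0r subrr.
- by rewrite oppr_eq0 oner_eq0.
- by rewrite evX_exp ev1X_exp !expr1.
- by rewrite evN ev1 mulN1r addrC subr_eq0 eq_sym.
Qed.

Let ev_nz x (q : {poly 'F_p}) : ~ alg x -> q != 0 -> evp x q != 0.
Proof. by move=> nalg q_nz; apply/negP => qx; apply: nalg; exists q. Qed.

(** Apply [height_key] to the Pade relation, of degree [N], or if it is degenerate to its
    derivative, of degree [N.+1]; the gain is at least [N] either way. If both are degenerate,
    [x ^ m * z1] is a rational function of [x ^ p], of height at least [p * h x]. *)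
Lemma height_odd_power x z1 z2 N : (0 < N)%N -> A x -> A z1 -> A z2 ->
  x ^+ N.*2.+1 * z1 + (1 - x) ^+ N.*2.+1 * z2 = 1 ->
  ~ alg x -> ~ alg (x ^+ N.*2.+1 * z1) -> (h (x ^+ N.*2.+1 * z1)%R < p * h x)%N ->
  (N * h x <= h z1 + h z2)%N.
Proof.
move=> N_gt0 Ax A1 A2 rel nax nay hy; set m := N.*2.+1 in rel nay hy.
have [a [b [c [sa sb sc c_nz abc]]]] := pade_exists 'F_p N.
have Xm_nz : 'X^m != 0 :> {poly 'F_p} by rewrite expf_neq0 // polyX_eq0.
have rel' : evp x 'X^m * z1 + evp x ((1 - 'X) ^+ m) * z2 = 1 by rewrite evX_exp ev1X_exp.
have key n (a' b' c' : {poly 'F_p}) : (size a' <= n.+1)%N -> (size c' <= n.+1)%N -> (n <= N.+1)%N ->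
    a' * 'X^m + b' * (1 - 'X) ^+ m + c' = 0 -> c' != 0 ->
    evp x c' * z1 + evp x a' != 0 -> (N * h x <= h z1 + h z2)%N.
  move=> sa' sc' len abc' c'_nz nd.
  apply: leq_trans (height_key hh Ax A1 A2 Xm_nz (pade_coprime _ m) (size_sub1X_exp _ m)
    sa' sc' abc' c'_nz rel' nd).
  by rewrite leq_mul2r /m -addnn; apply/orP; right; lia.
have [deg|nd] := eqVneq (evp x c * z1 + evp x a) 0; last by apply: (key N a b c).
pose a1 : {poly 'F_p} := 'X * (1 - 'X) * a^`() + m%:R * (1 - 'X) * a.
pose b1 : {poly 'F_p} := 'X * (1 - 'X) * b^`() - m%:R * 'X * b.
pose c1 : {poly 'F_p} := 'X * (1 - 'X) * c^`().
have abc1 : a1 * 'X^m + b1 * (1 - 'X) ^+ m + c1 = 0 := pade_deriv abc.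
have sX : (size ('X : {poly 'F_p}) <= 2)%N by rewrite size_polyX.
have sX1 : (size (1 - 'X : {poly 'F_p})%R <= 2)%N by rewrite -[1 - 'X]expr1 size_sub1X_exp.
have sd (q : {poly 'F_p}) : (size q <= N.+1)%N -> (size ('X * (1 - 'X) * q^`())%R <= N.+2)%N.
  move=> sq; have sq' : (size q^`() <= N.-1.+1)%N.
    rewrite prednK //; have [->|q_nz] := eqVneq q 0; first by rewrite deriv0 size_poly0.
    by rewrite -ltnS (leq_trans (lt_size_deriv q_nz)).
  by apply: leq_trans (size_mul_le (size_mul_le sX sX1) sq') _; rewrite -[in leqRHS](prednK N_gt0).
have sm (l q : {poly 'F_p}) : (size l <= 2)%N -> (size q <= N.+1)%N ->
    (size (m%:R * l * q)%R <= N.+2)%N.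
  move=> sl sq; rewrite -mulrA -polyC_natr mul_polyC; apply: leq_trans (size_scale_leq _ _) _.
  exact: size_mul_le sl sq.
have sa1 : (size a1 <= N.+2)%N.
  by apply: leq_trans (size_polyD _ _) _; rewrite geq_max sd // sm.
have sb1 : (size b1 <= N.+2)%N.
  by apply: leq_trans (size_polyD _ _) _; rewrite geq_max sd // size_polyN sm.
have sc1 : (size c1 <= N.+2)%N by exact: sd.
have [deg1|nd1] := eqVneq (evp x c1 * z1 + evp x a1) 0; last first.
  apply: (key N.+1 a1 b1 c1) => //.
  apply: contraNneq nd1 => c10; rewrite c10 addr0 in abc1.
  have [|-> _] := pade_trivial _ sb1 abc1; first by rewrite /m -addnn; lia.
  by rewrite c10 !ev0 mul0r addr0.
have cx := ev_nz nax c_nz.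
(* Both degenerate relations determine the same [z1], so [a / c = a1 / c1]; after division by
   [1 - X] this is a Wronskian condition. *)
have wr : a1 * c - a * c1 = 0.
  have cross (u v s t z : K) : v * z + u = 0 -> t * z + s = 0 -> s * v - u * t = 0.
    move=> /eqP; rewrite addrC addr_eq0 => /eqP -> /eqP; rewrite addrC addr_eq0 => /eqP ->.
    by ring.
  apply/eqP; apply: contraT => /(ev_nz nax)/eqP[].
  by rewrite evB [evp x (a1 * c)]evM [evp x (a * c1)]evM; exact: cross deg deg1.
have {}wr : 'X * (a^`() * c - a * c^`()) + m%:R * a * c = 0.
  apply: (@mulfI _ (1 - 'X)).
    by rewrite -size_poly_eq0 -[1 - 'X]expr1 size_sub1X_exp.
  by rewrite mulr0 -wr /a1 /c1; move: 'X a^`() c^`() m%:R => X a' c' M; ring.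
have pchF : p \in [pchar 'F_p] by rewrite pchar_Fp // (pcharf_prime pcharK).
have [w wE] := wronskian_pchar pchF wr.
have p_gt0 : (0 < p)%N by rewrite prime_gt0 // (pcharf_prime pcharK).
(* Here [x ^ m * z1 = - x ^ m * a(x) / c(x) = - w(x ^ p) / c(x ^ p)]. *)
have /(leq_trans (height_exp hh p Ax)) : (h (x ^+ p)%R <= h (x ^+ m * z1)%R)%N.
  apply: (height_rational hh (P := - w) (Q := c)) => //.
    rewrite -ev_frobenius evN.
    have evcomp : evp x (w \Po 'X^p) = evp (x ^+ p) w.
      rewrite comp_polyE [RHS](ev_sum _ _ (leqnn _)) rmorph_sum; apply: eq_bigr => i _.
      by rewrite /= -mul_polyC evM evC evXn evX_exp.
    rewrite -evcomp -wE !evM evX_exp evXn.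
    have -> : evp x c ^+ p = evp x c * evp x c ^+ p.-1 by rewrite -exprS prednK.
    move/eqP: deg; rewrite addr_eq0 => /eqP deg.
    by rewrite mulrA -[x ^+ m * z1 * _]mulrA [z1 * _]mulrC deg mulrN mulNr.
  by rewrite -ev_frobenius expf_neq0.
by rewrite leqNgt hy.
Qed.

End PairInequality.

(** * Packing *)

(** Bernoulli's inequality for [(1 + 1 / q) ^ k], cleared of denominators. *)
Lemma bernoulli_nat q k : (q ^ k * (q + k) <= q.+1 ^ k * q)%N.
Proof.
elim: k => [|k IH]; first by rewrite !expn0 addn0.
rewrite [in leqRHS]expnS -mulnA; apply: leq_trans (leq_mul (leqnn q.+1) IH).
by rewrite expnS; move: (q ^ k)%N => c; nia.
Qed.

Lemma leq_of_expn_bound M q C : (0 < q)%N -> (forall k, M ^ k <= C * q ^ k)%N -> (M <= q)%N.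
Proof.
move=> q_gt0 bnd; rewrite leqNgt; apply/negP => ltq; pose k := (C * q)%N.
have le1 : (q.+1 ^ k <= C * q ^ k)%N by apply: leq_trans (bnd k); case: (k) => [|k']; rewrite ?expn0 ?leq_exp2r.
have := leq_trans (bernoulli_nat q k) (leq_mul le1 (leqnn q)).
rewrite [(C * _)%N]mulnC -mulnA leq_pmul2l ?expn_gt0 ?q_gt0 // -/k.
by rewrite -{2}[k]add0n leq_add2r leqn0 -(ltn_predK q_gt0).
Qed.

Lemma shift_box (a : int) (B : nat) : (absz a <= B)%N ->
  (absz (a + B%:Z)%R < B.*2.+1)%N /\ (absz (a + B%:Z)%R)%:Z = a + B%:Z.
Proof.
move=> aB; have a0 : 0 <= a + B%:Z.
  by rewrite -lerBlDr sub0r lerNl (le_trans (ler_norm _)) // normrN -abszE lez_nat.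
have E : (absz (a + B%:Z)%R)%:Z = a + B%:Z by rewrite abszE ger0_norm.
split=> //; rewrite -ltz_nat E -addnn -addn1 !PoszD ltzD1 lerD2r.
by rewrite (le_trans (ler_norm _)) // -abszE lez_nat.
Qed.

Lemma uniq_map_inj (T T' : eqType) (f : T -> T') (s : seq T) :
  uniq (map f s) -> {in s &, injective f}.
Proof.
elim: s => //= a s IH /andP[na us] x y; rewrite !inE.
move=> /predU1P[->|sx] /predU1P[->|sy] // e; last exact: IH.
  by case/negP: na; rewrite e map_f.
by case/negP: na; rewrite -e map_f.
Qed.

Lemma abs_comb (a b : int) (c C : nat) : (absz a <= C)%N -> (absz b <= c * C)%N ->
  (absz (a *+ (18 * c) + b)%R <= 19 * c * C)%N.
Proof.
move=> aC bC; have : (absz (a *+ (18 * c) + b)%R <= 18 * c * absz a + absz b)%N.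
  by rewrite -lez_nat PoszD [Posz (18 * c * _)]PoszM !abszE -[Posz (18 * c)]natz mulr_natl
      -normrMn ler_normD.
move=> /leq_trans; apply; apply: leq_trans (leq_add (leq_mul (leqnn _) aC) bC) _.
by rewrite -mulnDl leq_mul2r -[X in (_ + X)%N]mul1n -mulnDl leqnn orbT.
Qed.

Lemma leq_exp2r_le m n e : (m <= n)%N -> (m ^ e <= n ^ e)%N.
Proof. by case: e => // e; rewrite leq_exp2r. Qed.

Section Packing.
Variables (G0 : zmodType) (G : G0 -> Prop) (r : nat).
Variables (phi : G0 -> {ffun 'I_r -> int}) (N : G0 -> nat).
Hypotheses (GD : forall x y, G x -> G y -> G (x + y)) (GN : forall x, G x -> G (- x)).
Hypothesis Gz : G 0.
Hypotheses (phiD : forall x y, G x -> G y -> phi (x + y) = phi x + phi y)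
  (phiN : forall x, G x -> phi (- x) = - phi x).
Hypotheses (ND : forall x y, G x -> G y -> (N (x + y) <= N x + N y)%N)
  (NN : forall x, G x -> N (- x) = N x)
  (NM : forall x n, G x -> N (x *+ n) = (n * N x)%N)
  (N_ker : forall x, G x -> phi x = 0 -> N x = 0%N).

Lemma closed_mulrn x n : G x -> G (x *+ n).
Proof. by move=> Gx; elim: n => [|n IH]; rewrite ?mulr0n // mulrS; apply: GD. Qed.

Lemma closed_sub x y : G x -> G y -> G (x - y).
Proof. by move=> Gx Gy; apply: GD => //; apply: GN. Qed.

Lemma coord0 : phi 0 = 0.
Proof. by apply: (addIr (phi 0)); rewrite -phiD // addr0 add0r. Qed.

Lemma coord_mulrn x n : G x -> phi (x *+ n) = phi x *+ n.
Proof.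
move=> Gx; elim: n => [|n IH]; first by rewrite !mulr0n coord0.
by rewrite !mulrS phiD ?IH //; exact: closed_mulrn.
Qed.

Lemma box_card (s : seq {ffun 'I_r -> int}) B : uniq s ->
  (forall f j, f \in s -> `|f j| <= B)%N -> (size s <= (B.*2.+1) ^ r)%N.
Proof.
move=> us sB; pose g (f : {ffun 'I_r -> int}) := [ffun j => inord `|f j + B%:Z|] : {ffun 'I_r -> 'I_B.*2.+1}.
have g_inj : {in s &, injective g}.
  move=> f1 f2 s1 s2 /ffunP eqg; apply/ffunP => j; have := eqg j.
  have := sB _ j s1; have := sB _ j s2; rewrite !ffunE => b2 b1 /(congr1 val).
  have [b1' b2'] := (shift_box b1, shift_box b2).
  by rewrite /= !inordK ?(b1'.1, b2'.1) // => /(congr1 Posz); rewrite b1'.2 b2'.2 => /addIr.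
rewrite -(size_map g) -[X in (_ <= X ^ _)%N]card_ord -[r in (_ ^ r)%N]card_ord -card_ffun.
have /card_uniqP <- : uniq (map g s) by rewrite map_inj_in_uniq.
exact: max_card.
Qed.

(** A discrete form of the volume argument with balls of radius 1/18 inside a ball of radius 19/18.
    Expansions in base 19 with digits [18 * v i] give [M ^ k] distinct integer points in a cube of
    side [O(19 ^ k)]; let [k] grow. *)
Lemma packing M D (v : 'I_M -> G0) : (forall i, G (v i)) -> (forall i, N (v i) <= D)%N ->
  (forall i j, i != j -> D < 9 * N (v i - v j))%N -> (M <= 19 ^ r)%N.
Proof.
move=> Gv Nv far.
have [C Cv] : exists C, forall i j, (`|phi (v i) j| <= C)%N.
  exists (\max_i \max_j `|phi (v i) j|%N) => i j.
  by apply: leq_trans (leq_bigmax i); exact: (leq_bigmax j).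
have pack k : exists s : seq G0, [/\ size s = (M ^ k)%N, uniq (map phi s),
    forall x, x \in s -> G x /\ (N x <= 19 ^ k * D)%N &
    forall x j, x \in s -> (`|phi x j| <= 19 ^ k * C)%N].
  elim: k => [|k [s [ss us sG sB]]].
    exists [:: 0]; split=> // [x|x j]; rewrite inE => /eqP ->.
      by split=> //; rewrite -[0](mulr0n 0) NM // mul0n.
    by rewrite coord0 ffunE.
  pose e := (18 * 19 ^ k)%N; pose f i x := v i *+ e + x.
  have fG i x : x \in s -> G (f i x).
    by move=> /sG[Gx _]; apply: GD => //; apply: closed_mulrn.
  exists [seq f i x | i <- enum 'I_M, x <- s]; split.
  - by rewrite size_allpairs size_enum_ord ss expnS.
  - rewrite map_allpairs; apply: allpairs_uniq; first exact: enum_uniq.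
      exact: map_uniq us.
    move=> _ _ /allpairsP[[i x] /= [_ sx ->]] /allpairsP[[j y] /= [_ sy ->]] /= eqf.
    have [[Gx Nx] [Gy Ny]] := (sG _ sx, sG _ sy).
    (* Different leading digits differ by more than [2 * 19 ^ k * D] in [N], which the tails, of
       size at most [19 ^ k * D] each, cannot compensate. *)
    have eij : i = j.
      apply/eqP/negPn/negP => /far; rewrite ltnNge => /negP[].
      have d0 : N (f i x - f j y) = 0%N.
        apply: N_ker; first by apply: closed_sub; exact: fG.
        by rewrite phiD ?phiN; [rewrite eqf subrr|exact: fG|exact: fG|exact/GN/fG].
      have E : (v i - v j) *+ e = (f i x - f j y) + (y - x).
        by rewrite mulrnBl /f opprD [v i *+ e + x + _]addrACA -[y - x]opprB addrK.
      have := NM e (closed_sub (Gv i) (Gv j)); rewrite E => eqN.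
      have := ND (closed_sub (fG i x sx) (fG j y sy)) (closed_sub Gy Gx).
      have := ND Gy (GN Gx); rewrite NN // eqN d0 /e.
      have : (0 < 19 ^ k)%N by rewrite expn_gt0.
      move: (N (v i - v j)) (N x) (N y) (N (y - x)) (19 ^ k)%N Nx Ny => n1 n2 n3 n4 c.
      by nia.
    rewrite eij in eqf *; congr (_, _); apply/eqP.
    move: eqf; rewrite phiD ?phiD //; try exact: closed_mulrn.
    by move=> /addrI/(uniq_map_inj us sx sy) ->.
  - move=> _ /allpairsP[[i x] /= [_ sx ->]]; split; first exact: fG.
    have [Gx Nx] := sG _ sx; apply: leq_trans (ND (closed_mulrn e (Gv i)) Gx) _.
    rewrite NM // expnS /e; have := Nv i; have : (0 < 19 ^ k)%N by rewrite expn_gt0.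
    by move: (19 ^ k)%N (N (v i)) (N x) Nx => c n1 n2; nia.
  - move=> _ j /allpairsP[[i x] /= [_ sx ->]].
    have [Gx Nx] := sG _ sx; rewrite phiD ?coord_mulrn //; last exact: closed_mulrn.
    rewrite ffunE ffunMnE expnS; apply: abs_comb (Cv i j) _; exact: sB.
apply: (@leq_of_expn_bound _ _ ((C.*2.+1) ^ r)); first by rewrite expn_gt0.
move=> k; have [s [<- us _ sB]] := pack k.
have := @box_card (map phi s) (19 ^ k * C) us; rewrite size_map => /(_ _).
move=> h; apply: (leq_trans (h _)) => [f j /mapP[x sx ->]|]; first exact: sB.
have -> : ((19 ^ r) ^ k = (19 ^ k) ^ r)%N by rewrite -!expnM mulnC.
rewrite -expnMn leq_exp2r_le //.
have : (0 < 19 ^ k)%N by rewrite expn_gt0.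
by rewrite -!muln2; move: (19 ^ k)%N => c; nia.
Qed.
End Packing.

(** * Counting *)

(* Four gaps of ratio 27/22 more than double, and 2^6 > 54. *)
Lemma ratio_chain (f : nat -> nat) : (forall n, (n < 24)%N -> (27 * f n <= 22 * f n.+1)%N) ->
  (f 24 < 54 * f 0)%N -> False.
Proof.
move=> gap.
have dbl n : (n.+3 < 24)%N -> (2 * f n <= f n.+4)%N.
  move=> lt; have lt1 := ltnW lt; have lt2 := ltnW lt1; have lt3 := ltnW lt2.
  by move: (gap _ lt) (gap _ lt1) (gap _ lt2) (gap _ lt3); lia.
by move: (dbl 0 isT) (dbl 4 isT) (dbl 8 isT) (dbl 12 isT) (dbl 16 isT) (dbl 20 isT);
  move: (f 0) (f 4) (f 8) (f 12) (f 16) (f 20) (f 24); clear; lia.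
Qed.

(** The odd number [k.*2.+1] is within 1 of [Y / X]. The inequalities then give
    [9 k X <= 4 Y + 18 X < (8 k + 26) X], so [k < 26]. *)
Lemma power_absurd n X Y (k := (Y %/ (2 * X))%N) : (0 < X -> 27 <= k -> k * X <= 2 * n ->
  9 * n <= 2 * Y + 9 * ((Y - k.*2.+1 * X) + (k.*2.+1 * X - Y)) -> False)%N.
Proof.
move=> X0 k27 h1 h2; have XX : (0 < 2 * X)%N by rewrite muln_gt0.
have := divn_eq Y (2 * X); have := ltn_pmod Y XX; rewrite -/k.
move: (Y %% _)%N k k27 h1 h2 => e k k27 h1 h2 lte YE.
have dist : ((Y - k.*2.+1 * X) + (k.*2.+1 * X - Y) <= X)%N by rewrite YE -addnn; lia.
by nia.
Qed.

Section Count.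
Variables (G0 : zmodType) (G : G0 -> Prop) (r : nat).
Variables (phi : G0 -> {ffun 'I_r -> int}) (N : G0 -> nat).
Hypotheses (GD : forall x y, G x -> G y -> G (x + y)) (GN : forall x, G x -> G (- x)).
Hypothesis Gz : G 0.
Hypotheses (phiD : forall x y, G x -> G y -> phi (x + y) = phi x + phi y)
  (phiN : forall x, G x -> phi (- x) = - phi x).
Hypotheses (ND : forall x y, G x -> G y -> (N (x + y) <= N x + N y)%N)
  (NN : forall x, G x -> N (- x) = N x)
  (NM : forall x n, G x -> N (x *+ n) = (n * N x)%N)
  (N_ker : forall x, G x -> phi x = 0 -> N x = 0%N).
Variables (p : nat) (Sol : G0 -> Prop).
Hypotheses (p_gt1 : (1 < p)%N) (SolG : forall x, Sol x -> G x)
  (SolN : forall x, Sol x -> (0 < N x)%N)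
  (SolF : forall x, Sol x -> Sol (x *+ p))
  (Sol_inj : forall x y, Sol x -> Sol y -> x *+ p = y *+ p -> x = y).
Hypothesis Sol_gap : forall x y, Sol x -> Sol y -> x <> y ->
  (N x <= N y < p * N x)%N -> (N x <= 2 * N (y - x))%N.
Hypothesis Sol_odd : forall x y k, Sol x -> Sol y -> x <> y ->
  (N x <= N y < p * N x)%N -> (0 < k)%N -> (k * N x <= 2 * N (y - x *+ k.*2.+1))%N.

Let GM := closed_mulrn GD Gz.
Let GB := closed_sub GD GN.

Lemma N_mulB x a b : G x -> (N (x *+ a - x *+ b) <= ((a - b) + (b - a)) * N x)%N.
Proof.
move=> Gx; have [le|/ltnW le] := leqP b a.
  by rewrite -mulrnBr // NM // leq_mul2r leq_addr orbT.
rewrite -NN; last by apply: GB; apply: GM.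
by rewrite opprB -mulrnBr // NM // leq_mul2r leq_addl orbT.
Qed.

(** Triangle inequality for [N x (y - m x) = (N x y - N y x) + (N y - m N x) x], divided by
    [N x]. *)
Lemma close_power x y m : G x -> G y -> (0 < N x)%N ->
  (9 * N (x *+ N y - y *+ N x) <= 2 * (N x * N y))%N ->
  (9 * N (y - x *+ m) <= 2 * N y + 9 * ((N y - m * N x) + (m * N x - N y)))%N.
Proof.
move=> Gx Gy X0 close.
rewrite -(leq_pmul2l X0).
have E : (y - x *+ m) *+ N x = (y *+ N x - x *+ N y) + (x *+ N y - x *+ (m * N x)).
  by rewrite mulrnBl -mulrnA addrA subrK.
have aux (n1 n2 n4 t X Y : nat) : (9 * n1 <= 2 * (X * Y) -> X * n4 <= n1 + n2 ->
  n2 <= t * X -> X * (9 * n4) <= X * (2 * Y + 9 * t))%N by nia.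
apply: aux close _ (N_mulB (N y) (m * N x) Gx).
rewrite -NM; last by apply: GB => //; exact: GM.
rewrite E -[N (x *+ N y - y *+ N x)]NN ?opprB; last by apply: GB; exact: GM.
by apply: ND; apply: GB; exact: GM.
Qed.

(** With [m = 1], [9 N x <= 18 N (y - x) <= 4 N y + 18 (N y - N x)], which is the factor 27/22. The
    factor 54 is twice the threshold 27 of [power_absurd]. *)
Lemma close_pair x y : Sol x -> Sol y -> x <> y -> (N x <= N y < p * N x)%N ->
  (9 * N (x *+ N y - y *+ N x) <= 2 * (N x * N y))%N ->
  (27 * N x <= 22 * N y)%N /\ (N y < 54 * N x)%N.
Proof.
move=> Sx Sy nxy le close; have [[Gx Gy] X0] := (SolG Sx, SolG Sy, SolN Sx).
case/andP: (le) => XY _; split.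
  have := close_power 1 Gx Gy X0 close; have := Sol_gap Sx Sy nxy le.
  by rewrite mulr1n mul1n; lia.
rewrite ltnNge; apply/negP => le54.
have k27 : (27 <= N y %/ (2 * N x))%N by rewrite leq_divRL ?muln_gt0 //; lia.
apply: (@power_absurd _ (N x) (N y) X0 k27 (Sol_odd Sx Sy nxy le _)).
  by apply: leq_trans k27.
exact: close_power.
Qed.

Lemma frob_iter x k : Sol x -> Sol (x *+ (p ^ k)).
Proof.
by move=> Sx; elim: k => [|k IH]; rewrite ?expn0 ?mulr1n // expnSr mulrnA; apply: SolF.
Qed.

Lemma frob_inj x y k : Sol x -> Sol y -> x *+ (p ^ k) = y *+ (p ^ k) -> x = y.
Proof.
move=> Sx Sy; elim: k => [|k IH]; first by rewrite expn0 !mulr1n.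
by rewrite expnSr !mulrnA => /(Sol_inj (frob_iter k Sx) (frob_iter k Sy)).
Qed.

Lemma frob_window a H : (0 < a)%N -> (a <= H)%N ->
  exists k, (H <= p ^ k * a)%N /\ (p ^ k * a < p * H)%N.
Proof.
move=> a_gt0 aH.
have ex : exists k, (H <= p ^ k * a)%N.
  by exists H; rewrite (leq_trans (ltnW (ltn_expl H p_gt1))) // leq_pmulr.
have [k kP mink] := ex_minnP ex; exists k; split=> //.
case: k kP mink => [|k] kP mink.
  by rewrite expn0 mul1n (leq_ltn_trans aH) // -{1}[H]mul1n ltn_pmul2r // (leq_trans a_gt0).
rewrite expnS -mulnA ltn_pmul2l ?(ltnW p_gt1) // ltnNge; apply/negP => /mink.
by rewrite ltnn.
Qed.

(** The negation of closeness: [x / N x] and [y / N y] are at distance more than 1/9. *)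
Definition nclose x y := (N x * N y < 9 * N (x *+ N y - y *+ N x))%N.

Section Family.
Variables (M : nat) (u : 'I_M -> G0).
Hypotheses (uS : forall i, Sol (u i)) (u_inj : injective u)
  (u_frob : forall i g, G g -> u i <> g *+ p).
Let X i := N (u i).
Let uG i : G (u i) := SolG (uS i).

(** Closeness is invariant under scaling, so it survives moving the points by powers of [p] into one
    window. Sorting 25 of them by size would contradict [ratio_chain]. *)
Lemma cluster (C : {set 'I_M}) : (forall i j, i \in C -> j \in C ->
    (9 * N (u i *+ X j - u j *+ X i) <= 2 * (X i * X j))%N) -> (#|C| <= 24)%N.
Proof.
move=> close; rewrite leqNgt; apply/negP => C25.
pose H := \max_i X i.
have /choice[k kP] i := frob_window (SolN (uS i)) (leq_bigmax i : (X i <= H)%N).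
pose w i := u i *+ (p ^ k i).
have Sw i : Sol (w i) by exact: frob_iter.
have Nw i : N (w i) = (p ^ k i * X i)%N by rewrite NM.
(* If different powers of [p] were used, cancelling the smaller one would make some [u i] a multiple
   of [p] in [G]. *)
have w_inj i j : w i = w j -> i = j.
  move=> eqw; wlog le : i j eqw / (k i <= k j)%N.
    by move=> W; case/orP: (leq_total (k i) (k j)) => /W; [apply|move=> /(_ (esym eqw)) ->].
  have eq2 : u i = u j *+ (p ^ (k j - k i)).
    apply: (@frob_inj _ _ (k i)) => //; first exact: frob_iter.
    by rewrite -mulrnA -expnD subnK.
  have [lt|ge] := ltnP 0 (k j - k i); last first.
    by move: ge; rewrite leqn0 => /eqP kk; apply: u_inj; rewrite eq2 kk expn0 mulr1n.
  case: (@u_frob i (u j *+ (p ^ (k j - k i).-1))); first exact: GM.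
  by rewrite -mulrnA -expnSr prednK.
have pair i j : i \in C -> j \in C -> i != j -> (N (w i) <= N (w j))%N ->
    (27 * N (w i) <= 22 * N (w j))%N /\ (N (w j) < 54 * N (w i))%N.
  move=> iC jC nij le; apply: close_pair => //.
  - by move=> /w_inj/eqP; apply/negP.
  - rewrite le /= !Nw; have [_ lt] := kP j; have [ge _] := kP i.
    by apply: leq_trans lt _; rewrite leq_mul2l ge orbT.
  have -> : w i *+ N (w j) - w j *+ N (w i) = (u i *+ X j - u j *+ X i) *+ (p ^ k i * p ^ k j).
    rewrite mulrnBl /w -!mulrnA !Nw; congr (_ *+ _ - _ *+ _).
      by rewrite mulnA mulnC.
    by rewrite mulnCA mulnA mulnC.
  rewrite NM; last by apply: GB; apply: GM.
  have aux n1 a b c d : (9 * n1 <= 2 * (a * b) -> 9 * (c * d * n1) <= 2 * (c * a * (d * b)))%N.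
    have -> : (9 * (c * d * n1) = c * d * (9 * n1))%N by ring.
    have -> : (2 * (c * a * (d * b)) = c * d * (2 * (a * b)))%N by ring.
    exact: leq_mul.
  by rewrite !Nw; apply/aux/close.
pose s := sort (fun i j => N (w i) <= N (w j))%N (enum C).
have ss : size s = #|C| by rewrite size_sort cardE.
have us : uniq s by rewrite sort_uniq enum_uniq.
have sC i : i \in s -> i \in C by rewrite mem_sort mem_enum.
have [i0 i0C] : exists i0, i0 \in C by apply/set0Pn; rewrite -card_gt0 (leq_trans _ C25).
have srt : sorted (fun i j => N (w i) <= N (w j))%N s.
  by apply: sort_sorted => i j; exact: leq_total.
pose f n := N (w (nth i0 s n)).
have le_f a b : (a <= b)%N -> (b < size s)%N -> (f a <= f b)%N.
  have tr : transitive (fun i j => N (w i) <= N (w j))%N by move=> y x z; exact: leq_trans.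
  have rf : reflexive (fun i j => N (w i) <= N (w j))%N by move=> x; exact: leqnn.
  move=> ab bs; apply: (sorted_leq_nth tr rf i0 srt) => //; rewrite inE //.
  exact: leq_ltn_trans ab bs.
have fpair a b : (a < b)%N -> (b < size s)%N -> (27 * f a <= 22 * f b)%N /\ (f b < 54 * f a)%N.
  move=> ab bs; have as_ := ltn_trans ab bs.
  apply: pair; rewrite ?sC ?mem_nth ?nth_uniq ?neq_ltn ?ab //.
  exact: le_f (ltnW ab) bs.
apply: (@ratio_chain f) => [n n24|]; last by apply: (fpair 0 24 _ _).2; rewrite ?ss.
by apply: (fpair n n.+1 _ _).1; rewrite ?ss // (leq_ltn_trans n24).
Qed.

Lemma ncloseC x y : G x -> G y -> nclose x y = nclose y x.
Proof.
move=> Gx Gy; rewrite /nclose mulnC; congr (_ < 9 * _)%N; rewrite -NN ?opprB //.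
by apply: GB; apply: GM.
Qed.

(** Multiplying [u i] by the product of the other sizes gives all points the same size [D], as
    [packing] wants. *)
Lemma nclose_card (T : {set 'I_M}) :
  (forall i j, i \in T -> j \in T -> i != j -> nclose (u i) (u j)) -> (#|T| <= 19 ^ r)%N.
Proof.
move=> far; pose D := (\prod_i X i)%N; pose e i := (\prod_(j | j != i) X j)%N.
have DE i : D = (X i * e i)%N by rewrite /D (bigD1 i).
apply: (@packing _ _ _ _ _ GD GN Gz phiD phiN ND NN NM N_ker #|T| D
  (fun a => u (enum_val a) *+ e (enum_val a))) => [a|a|a b nab].
- exact: GM.
- by rewrite NM // mulnC -DE.
have nij : enum_val a != enum_val b by rewrite (inj_eq enum_val_inj).
have := far _ _ (enum_valP a) (enum_valP b) nij; rewrite /nclose.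
move: (enum_val a) (enum_val b) nij => i j nij.
pose g := (\prod_(l | (l != i) && (l != j)) X l)%N.
have g_gt0 : (0 < g)%N by apply: prodn_cond_gt0 => l _; exact: SolN.
have ei : e i = (X j * g)%N by rewrite /e (bigD1 j) //= eq_sym.
have ej : e j = (X i * g)%N.
  by rewrite /e (bigD1 i) //=; congr (_ * _)%N; apply: eq_bigl => l; rewrite andbC.
have -> : u i *+ e i - u j *+ e j = (u i *+ X j - u j *+ X i) *+ g.
  by rewrite mulrnBl -!mulrnA ei ej.
rewrite NM; last by apply: GB; apply: GM.
have aux n1 a1 b1 : (a1 * b1 < 9 * n1 -> a1 * (b1 * g) < 9 * (g * n1))%N by nia.
by rewrite (DE i) ei; exact: aux.
Qed.

(** Take a maximal set [T] of pairwise far points. Every point is within 1/9 of some member of [T],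
    so points sharing a member are within 2/9 of each other and form a cluster. *)
Theorem family_card : (M <= 24 * 19 ^ r)%N.
Proof.
pose far (T : {set 'I_M}) := [forall i in T, forall j in T, (i != j) ==> nclose (u i) (u j)].
have far0 : far (finset.set0 : {set _}) by apply/forall_inP => i; rewrite inE.
case: (arg_maxnP (fun T : {set 'I_M} => #|T|) far0) => T farT maxT.
have farP i j : i \in T -> j \in T -> i != j -> nclose (u i) (u j).
  by move=> iT jT; move/forall_inP/(_ i iT)/forall_inP/(_ j jT)/implyP: farT.
have cardT := nclose_card farP.
have nrefl i : ~~ nclose (u i) (u i) by rewrite /nclose subrr -(mulr0n 0) NM // mul0n muln0.
have /choice[tau tauP] i : exists c, (c \in T) && ~~ nclose (u i) (u c).
  apply/existsP; apply: contraT; rewrite negb_exists => /forallP all_far.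
  have iT : i \notin T by have := all_far i; rewrite nrefl andbT.
  have {}all_far c : c \in T -> nclose (u i) (u c).
    by move=> cT; have := all_far c; rewrite cT /= negbK.
  have : far (i |: T).
    apply/forall_inP => a aT; apply/forall_inP => b bT; apply/implyP => nab.
    case/setU1P: aT nab => [->|aT]; case/setU1P: bT => [->|bT]; rewrite ?eqxx // => nab.
    - exact: all_far.
    - by rewrite ncloseC //; exact: all_far.
    - exact: farP.
  by move/maxT; rewrite cardsU1 iT /= add1n ltnn.
have tauT i : tau i \in T by case/andP: (tauP i).
have cl c : (#|[set i | tau i == c]| <= 24)%N.
  apply: cluster => i j; rewrite !inE => /eqP ti /eqP tj.
  have := tauP i; have := tauP j; rewrite ti tj /nclose -!leqNgt => /andP[_ h2] /andP[_ h1].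
  rewrite -(leq_pmul2l (SolN (uS c))) -/(X c).
  (* The triangle inequality through [u c], cleared of denominators. *)
  have E : (u i *+ X j - u j *+ X i) *+ X c =
    (u i *+ X c - u c *+ X i) *+ X j + (u c *+ X j - u j *+ X c) *+ X i.
    rewrite !mulrnBl -!mulrnA [(X c * X j)%N]mulnC [(X c * X i)%N]mulnC.
    by rewrite [(X i * X j)%N]mulnC addrA subrK.
  have GA a b : G (u a *+ X b - u b *+ X a) by apply: GB; apply: GM.
  have := NM (X c) (GA i j); rewrite E => eqN.
  have := ND (GM (X j) (GA i c)) (GM (X i) (GA c j)); rewrite eqN !NM //.
  have : N (u c *+ X j - u j *+ X c) = N (u j *+ X c - u c *+ X j).
    by rewrite -NN ?opprB.
  have aux n1 n2 n3 a b d : (9 * n1 <= a * d -> 9 * n2 <= b * d ->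
    d * n3 <= b * n1 + a * n2 -> d * (9 * n3) <= d * (2 * (a * b)))%N by nia.
  by move=> -> le; exact: aux h1 h2 le.
apply: leq_trans (leq_mul (leqnn 24) cardT).
have -> : (24 * #|T| = \sum_(c in T) 24)%N by rewrite sum_nat_const mulnC.
have {1}-> : (M = \sum_(i < M) 1)%N by rewrite sum1_card card_ord.
rewrite (partition_big tau (mem T)) //= leq_sum // => c _.
rewrite sum1dep_card; apply: leq_trans (cl c); apply: subset_leq_card.
by apply/fintype.subsetP => i; rewrite !inE.
Qed.

End Family.
End Count.

(** * The rank of G *)

Section AdditivePairs.
Variable K : fieldType.

(* [K^* x K^*] written additively. *)
Definition addpair := (mulgrp K * mulgrp K)%type.
HB.instance Definition _ := Choice.on addpair.

Definition addpair_add (x y : addpair) : addpair := ((x : mulgrp K * mulgrp K) * y)%g.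
Definition addpair_opp (x : addpair) : addpair := ((x : mulgrp K * mulgrp K)^-1)%g.
Fact addpairA : associative addpair_add. Proof. by move=> x y z; exact: mulgA. Qed.
Fact addpairC : commutative addpair_add.
Proof. by move=> [x1 x2] [y1 y2]; congr (_, _); apply: val_inj; exact: mulrC. Qed.
Fact addpair0 : left_id (1%g : addpair) addpair_add. Proof. by move=> x; exact: mul1g. Qed.
Fact addpairN : left_inverse (1%g : addpair) addpair_opp addpair_add.
Proof. by move=> x; exact: mulVg. Qed.
HB.instance Definition _ := GRing.isZmodule.Build addpair addpairA addpairC addpair0 addpairN.

Lemma addpair_mulrn (x : addpair) n : x *+ n = ((x : mulgrp K * mulgrp K) ^+ n)%g.
Proof. by elim: n => [|n IH]; rewrite ?mulr0n // mulrS IH expgS. Qed.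

Lemma addpair_val1 (x : addpair) n : val (x *+ n).1 = val x.1 ^+ n.
Proof. by elim: n => [|n IH]; rewrite ?mulr0n // mulrS exprS -IH. Qed.

Lemma addpair_val2 (x : addpair) n : val (x *+ n).2 = val x.2 ^+ n.
Proof. by elim: n => [|n IH]; rewrite ?mulr0n // mulrS exprS -IH. Qed.

End AdditivePairs.

(* The quotient of sequences by eventual equality is a target in which every
   non-torsion element of an abelian group survives: [g (x) q] is sent to the
   sequence [k |-> (q k!) g], which makes sense for large [k]. *)
Section EventualQuotient.
Variable V : zmodType.

Definition eventually0 : {pred nat -> V} :=
  fun f => `[< exists n, forall k, (n <= k)%N -> f k = 0 >].
Fact eventually0_closed : zmod_closed eventually0.
Proof.
split; first by apply/asboolP; exists 0%N.
move=> f g /asboolP[n fn] /asboolP[m gm]; apply/asboolP; exists (maxn n m) => k.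
by rewrite geq_max => /andP[/fn fk /gm gk]; rewrite -[(f - g) k]/(f k - g k) fk gk subr0.
Qed.
HB.instance Definition _ := GRing.isZmodClosed.Build (nat -> V) eventually0 eventually0_closed.

Definition germ := Quotient.quot eventually0.
Definition germ_of (f : nat -> V) : germ := \pi_germ%qT f.

Lemma germ_ofD f g : germ_of (f + g) = germ_of f + germ_of g.
Proof. exact: (@Quotient.pi_add _ eventually0). Qed.

Lemma germ_of_eq f g : (exists n, forall k, (n <= k)%N -> f k = g k) -> germ_of f = germ_of g.
Proof.
move=> [n fg]; apply/eqP; rewrite /germ_of -Quotient.idealrBE; apply/asboolP.
by exists n => k /fg fk; rewrite -[(f - g) k]/(f k - g k) fk subrr.
Qed.

Lemma germ_of_eq0 f : germ_of f = 0 -> exists n, forall k, (n <= k)%N -> f k = 0.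
Proof.
have germ0 : germ_of 0 = 0 by apply: (addIr (germ_of 0)); rewrite -germ_ofD addr0 add0r.
by rewrite -germ0 => /eqP; rewrite /germ_of -Quotient.idealrBE subr0 => /asboolP.
Qed.

End EventualQuotient.

Lemma int_fact_mul (q : rat) k : (`|denq q| <= k)%N -> q * (k`!)%:R \is a Num.int.
Proof.
move=> le; have d0 : (denq q)%:~R != 0 :> rat by rewrite intr_eq0 denq_neq0.
rewrite -[q]divq_num_den mulrAC pmulrn -intrM; apply: Qint_dvdz.
by rewrite dvdz_mull // dvdzE /= dvdn_fact // absz_gt0 denq_neq0.
Qed.

Lemma numqD_int (a b : rat) : a \is a Num.int -> b \is a Num.int ->
  numq (a + b) = numq a + numq b.
Proof. by move=> /intrP[m ->] /intrP[n ->]; rewrite -intrD !numq_int. Qed.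

Lemma numqN_int (a : rat) : a \is a Num.int -> numq (- a) = - numq a.
Proof. by move=> /intrP[m ->]; rewrite -intrN !numq_int. Qed.

(** * Integer coordinates on G modulo torsion *)

Section Rank.
Variables (K : fieldType) (G : set (mulgrp K * mulgrp K)).
Variables (V : vectType rat) (t : mulgrp K * mulgrp K -> rat -> V).
Hypotheses (tG : is_tensor_rat G t) (G1 : G 1%g)
  (GM : forall g h, G g -> G h -> G (g * h)%g) (GV : forall g, G g -> G (g^-1)%g).

(** By the universal property the germ of [k! g] is the image of [t g 1], so it vanishes and some
    factorial kills [g]. *)
Lemma tensor_kernel_torsion (g : addpair K) : G g -> t g 1 = 0 ->
  exists2 n, (0 < n)%N & g *+ n = 0.
Proof.
move=> Gg tg0; case: tG => _ _ univ.
pose b (h : mulgrp K * mulgrp K) (q : rat) : germ (addpair K) :=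
  germ_of (fun k => (h : addpair K) *~ numq (q * (k`!)%:R)).
have [|f fb _] := univ _ b.
  split=> [h h' q _ _|h q q' _].
    rewrite /b -germ_ofD; apply: germ_of_eq; exists 0%N => k _.
    exact: (mulrzDl (numq _) (h : addpair K) (h' : addpair K)).
  rewrite /b -germ_ofD; apply: germ_of_eq; exists (maxn `|denq q| `|denq q'|) => k.
  rewrite geq_max => /andP[le le'].
  by rewrite mulrDl numqD_int ?int_fact_mul // mulrzDr.
have := fb g 1 Gg; rewrite tg0 raddf0 => /esym/germ_of_eq0[n nP].
exists n`!; first exact: fact_gt0.
by have := nP n (leqnn n); rewrite mul1r -[(n`!)%:R]/((n`!)%:Z%:~R) numq_int -pmulrn.
Qed.

(** The coordinates of [t g 1] in a basis of [V] have a common denominator [d], taken from the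
    generators; multiplying by it makes them integers. *)
Lemma rank_coordinates : finitely_generated G ->
  exists phi : addpair K -> {ffun 'I_(\dim {:V}) -> int},
  [/\ forall x y : addpair K, G x -> G y -> phi (x + y) = phi x + phi y,
      forall x : addpair K, G x -> phi (- x) = - phi x &
      forall x : addpair K, G x -> phi x = 0 -> exists2 n, (0 < n)%N & x *+ n = 0].
Proof.
move=> [S /finite_seqP[s sE] GE].
have [bi _ _] := tG; have [tD _] := bi.
have t1 : t 1%g 1 = 0.
  by apply: (addIr (t 1%g 1)); rewrite add0r -tD // mulg1.
have tV g : G g -> t (g^-1)%g 1 = - t g 1.
  by move=> Gg; apply/eqP; rewrite -addr_eq0 -tD ?mulVg ?t1 //; exact: GV.
pose c g (j : 'I_(\dim {:V})) : rat := coord (vbasis {:V}) j (t g 1).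
have cD g h j : G g -> G h -> c (g * h)%g j = c g j + c h j.
  by move=> Gg Gh; rewrite /c tD // linearD.
have cV g j : G g -> c (g^-1)%g j = - c g j by move=> Gg; rewrite /c tV // linearN.
pose d : int := \prod_(g <- s) \prod_j denq (c g j).
have d_nz : d != 0.
  by rewrite prodf_seq_neq0; apply/allP => g _; apply/prodf_neq0 => j _; rewrite denq_neq0.
have sint g j : g \in s -> d%:~R * c g j \is a Num.int.
  move=> gs; rewrite /d (perm_big _ (perm_to_rem gs)) big_cons (bigD1 j) //=.
  by rewrite -mulrA intrM mulrAC [_ * c g j]mulrC -numqE -intrM intr_int.
have Gint g : G g -> forall j, d%:~R * c g j \is a Num.int.
  move=> Gg; have : smallest (@subgroup _) S g by rewrite -GE.
  move=> /(_ (fun h => G h /\ forall j, d%:~R * c h j \is a Num.int)) []//.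
  split=> [|h hS]; last first.
    split; first by rewrite GE => B [_]; apply.
    by move=> j; apply: sint; move: hS; rewrite sE.
  split=> [|x y]; rewrite !inE /=.
    by split=> // j; rewrite /c t1 linear0 mulr0 int_num0.
  move=> [Gx xi] [Gy yi]; split; first by apply: GM => //; exact: GV.
  by move=> j; rewrite cD ?cV //; [rewrite mulrBr rpredB | exact: GV].
exists (fun g => [ffun j => numq (d%:~R * c g j)]); split.
- move=> x y Gx Gy; apply/ffunP => j; rewrite !ffunE.
  by rewrite -numqD_int ?Gint // -mulrDr -cD.
- move=> x Gx; apply/ffunP => j; rewrite !ffunE -numqN_int ?Gint //.
  by rewrite -mulrN -cV.
- move=> x Gx /ffunP x0; apply: tensor_kernel_torsion => //.
  rewrite (coord_vbasis (memvf (t x 1))) big1 // => j _.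
  have := x0 j; rewrite !ffunE => /eqP.
  by rewrite numq_eq0 mulf_eq0 intr_eq0 (negPf d_nz) => /eqP; rewrite /c => ->; rewrite scale0r.
Qed.

End Rank.

(** * Symmetrized heights *)

Section SymmetricHeight.
Variables (p : nat) (K : fieldType) (pcharK : p \in [pchar K]).
Local Notation alg := (algebraicOver (fp pcharK)).
Variables (A : K -> Prop) (h : K -> nat).
Hypotheses (hh : is_height pcharK A h) (A1 : A 1)
  (AM : forall x y, A x -> A y -> A (x * y)) (AV : forall x, A x -> A x^-1).

Lemma closed_exp x n : A x -> A (x ^+ n).
Proof. by move=> Ax; elim: n => [|n IH]; rewrite ?expr0 // exprS; apply: AM. Qed.

Lemma height1 : h 1 = 0%N.
Proof. by have := height_exp hh 2 A1; rewrite expr1n; lia. Qed.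

Lemma height_expE x n : A x -> h (x ^+ n) = (n * h x)%N.
Proof.
move=> Ax; apply/eqP; rewrite eqn_leq (height_exp hh) // andbT.
elim: n => [|n IH]; first by rewrite expr0 height1.
by rewrite exprS mulSn (leq_trans (height_mul hh Ax (closed_exp n Ax))) // leq_add2l.
Qed.

Lemma height_opp w : ~ alg w -> (h (- w) <= h w)%N.
Proof.
move=> nw; apply: (height_rational hh (P := - 'X) (Q := 1)) => //.
  by rewrite ev1 mulr1 evN evX opprK.
by rewrite ev1 oner_neq0.
Qed.

Lemma height_oppE w : ~ alg w -> h (- w) = h w.
Proof.
move=> nw; apply/eqP; rewrite eqn_leq height_opp // -[X in (h X <= _)%N]opprK height_opp //.
by move=> /algebraic_opp; rewrite opprK.
Qed.

Lemma height_ratio x : x != 1 -> ~ alg x -> h (x / (1 - x)) = h x.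
Proof.
move=> x1 nx; have d : 1 - x != 0 by rewrite subr_eq0 eq_sym.
have -> : x / (1 - x) = - (1 - (1 - x)^-1) by field.
rewrite height_oppE; first by rewrite (height_sub1 hh) (height_inv hh) (height_sub1 hh).
move=> a; apply: nx; rewrite -[x](subKr 1); apply: algebraic_sub; first exact: algebraic1.
by rewrite -[1 - x]invrK; apply: algebraic_inv; rewrite -[_^-1](subKr 1);
  apply: algebraic_sub => //; exact: algebraic1.
Qed.

Definition hpair (a b : K) := (h a + h b + h (a / b))%N.

(** The same relation read at [x], [1 / x] and [1 / (1 - x)]. Oddness of [m] absorbs the sign in
    [1 - 1 / x = - (1 - x) / x]. *)
Lemma pair_relations (x y z1 z2 : K) m : odd m -> x != 0 -> 1 - x != 0 ->
  z1 != 0 -> z2 != 0 -> y = x ^+ m * z1 -> 1 - y = (1 - x) ^+ m * z2 ->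
  [/\ x ^+ m * z1 + (1 - x) ^+ m * z2 = 1,
      x^-1 ^+ m * z1^-1 + (1 - x^-1) ^+ m * (z2 / z1) = 1 &
      (1 - x)^-1 ^+ m * z2^-1 + (1 - (1 - x)^-1) ^+ m * (z1 / z2) = 1].
Proof.
move=> om x0 x1 z10 z20 yE y1E.
have sgn (a : K) : (- a) ^+ m = - a ^+ m by rewrite exprNn -signr_odd om expr1 mulN1r.
have X0 := expf_neq0 m x0; have X1 := expf_neq0 m x1.
have rel : x ^+ m * z1 + (1 - x) ^+ m * z2 = 1 by rewrite -yE -y1E addrC subrK.
split=> //.
  have -> : 1 - x^-1 = - ((1 - x) / x) by field.
  rewrite sgn expr_div_n exprVn; move: rel X0; move: (x ^+ m) ((1 - x) ^+ m) => X Y rel X0.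
  have -> : X^-1 / z1 + - (Y / X) * (z2 / z1) = (1 - Y * z2) / (X * z1) by field; rewrite X0 z10.
  by rewrite -rel addrK divff // mulf_neq0.
have -> : 1 - (1 - x)^-1 = - (x / (1 - x)) by field.
rewrite sgn expr_div_n exprVn; move: rel X1; move: (x ^+ m) ((1 - x) ^+ m) => X Y rel X1.
have -> : Y^-1 / z2 + - (X / Y) * (z1 / z2) = (1 - X * z1) / (Y * z2) by field; rewrite X1 z20.
by rewrite -rel addrC addKr divff // mulf_neq0.
Qed.

(** The three relations bound [h x] by the three pairwise sums of [h z1], [h z2] and [h (z1 / z2)],
    which add up to twice [hpair]. *)
Lemma hpair_gap x y : A x -> A (1 - x) -> A y -> A (1 - y) -> x != 0 -> 1 - x != 0 ->
  y != 0 -> 1 - y != 0 -> x != y ->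
  (3 * h x <= 2 * hpair (y / x) ((1 - y) / (1 - x)))%N.
Proof.
move=> Ax A1x Ay A1y x0 x1 y0 y1 xy; set z1 := y / x; set z2 := (1 - y) / (1 - x).
have z10 : z1 != 0 by rewrite mulf_neq0 ?invr_eq0.
have z20 : z2 != 0 by rewrite mulf_neq0 ?invr_eq0.
have Az1 : A z1 by apply: AM => //; exact: AV.
have Az2 : A z2 by apply: AM => //; exact: AV.
have [//|//|//|//|||r1 r2 r3] := @pair_relations x y z1 z2 1 isT; rewrite ?expr1.
- by rewrite /z1 mulrCA divff // mulr1.
- by rewrite /z2 mulrCA divff // mulr1.
rewrite !expr1 in r1 r2 r3.
have z11 : z1 != 1.
  by apply: contraNneq xy => E; rewrite -[x]mul1r -E /z1 divfK.
have z21 : z2 != 1.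
  apply: contraNneq xy => E; have := divfK x1 (1 - y); rewrite -/z2 E mul1r.
  by move=> /(congr1 (fun a => 1 - a)); rewrite !subKr => ->.
have h1 := height_quotient hh Ax Az1 Az2 r1 z11.
have h2 := height_quotient hh (AV Ax) (AV Az1) (AM Az2 (AV Az1)) r2 (_ : z1^-1 != 1).
have h3 := height_quotient hh (AV A1x) (AV Az2) (AM Az1 (AV Az2)) r3 (_ : z2^-1 != 1).
move: h2 h3; rewrite !invr_eq1 => /(_ z11) h2 /(_ z21).
have E : h (z2 / z1) = h (z1 / z2) by rewrite -(height_inv hh) invf_div.
move: h1 h2; rewrite /hpair E !(height_inv hh) (height_sub1 hh); lia.
Qed.

Lemma hpair_odd_power x y N : (0 < N)%N -> A x -> A (1 - x) -> A y -> A (1 - y) ->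
  ~ alg x -> ~ alg y -> (h y < p * h x)%N ->
  (3 * (N * h x) <= 2 * hpair (y / x ^+ N.*2.+1) ((1 - y) / (1 - x) ^+ N.*2.+1))%N.
Proof.
move=> N0 Ax A1x Ay A1y nx ny hy; set m := N.*2.+1.
have nalg1 w : ~ alg w -> ~ alg (1 - w).
  by move=> nw a; apply: nw; rewrite -[w](subKr 1); apply: algebraic_sub => //; exact: algebraic1.
have nalgV w : ~ alg w -> ~ alg w^-1.
  by move=> nw a; apply: nw; rewrite -[w]invrK; exact: algebraic_inv.
have nalg0 w : ~ alg w -> w != 0.
  by move=> nw; apply/eqP => w0; apply: nw; rewrite w0; exact: algebraic0.
have [x0 x1 y0 y1] := And4 (nalg0 _ nx) (nalg0 _ (nalg1 _ nx)) (nalg0 _ ny) (nalg0 _ (nalg1 _ ny)).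
set z1 := y / _; set z2 := (1 - y) / _.
have z10 : z1 != 0 by rewrite mulf_neq0 ?invr_eq0 ?expf_neq0.
have z20 : z2 != 0 by rewrite mulf_neq0 ?invr_eq0 ?expf_neq0.
have Az1 : A z1 by apply: AM => //; apply: AV; exact: closed_exp.
have Az2 : A z2 by apply: AM => //; apply: AV; exact: closed_exp.
have yE : y = x ^+ m * z1 by rewrite /z1 mulrCA divff ?mulr1 ?expf_neq0.
have y1E : 1 - y = (1 - x) ^+ m * z2 by rewrite /z2 mulrCA divff ?mulr1 ?expf_neq0.
have [|r1 r2 r3] := @pair_relations x y z1 z2 m _ x0 x1 z10 z20 yE y1E.
  by rewrite /m /= odd_double.
have h1 := height_odd_power hh N0 Ax Az1 Az2 r1 nx.
have h2 := height_odd_power hh N0 (AV Ax) (AV Az1) (AM Az2 (AV Az1)) r2 (nalgV _ nx).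
have h3 := height_odd_power hh N0 (AV A1x) (AV Az2) (AM Az1 (AV Az2)) r3 (nalgV _ (nalg1 _ nx)).
rewrite -yE in h1.
have E2 : x^-1 ^+ m * z1^-1 = y^-1 by rewrite exprVn -invfM -yE.
have E3 : (1 - x)^-1 ^+ m * z2^-1 = (1 - y)^-1 by rewrite exprVn -invfM -y1E.
rewrite E2 !(height_inv hh) in h2; rewrite E3 !(height_inv hh) !(height_sub1 hh) in h3.
have {}h1 := h1 ny hy; have {}h2 := h2 (nalgV _ ny) hy.
have {}h3 := h3 (nalgV _ (nalg1 _ ny)) hy.
have E : h (z2 / z1) = h (z1 / z2) by rewrite -(height_inv hh) invf_div.
by move: h1 h2 h3; rewrite /hpair E; lia.
Qed.

End SymmetricHeight.

(** * Frobenius *)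

Lemma card_family (T : choiceType) (A : set T) n : ~ (A #<= `I_n)%card ->
  exists2 u : 'I_n.+1 -> T, injective u & forall i, A (u i).
Proof.
move=> nle; have [s [us sA ns]] : exists s : seq T, [/\ uniq s, forall x, x \in s -> A x & (n < size s)%N].
  have [/finite_fsetP[X AX]|/infinite_set_fset-/(_ n.+1)[X XA nX]] := pselect (finite_set A).
    exists (finmap.enum_fset X); split; first exact: finmap.fset_uniq.
      by move=> x xX; rewrite AX.
    rewrite ltnNge; apply/negP => le; apply: nle.
    by have /card_eq_fsetP XE := erefl (size (finmap.enum_fset X)); rewrite AX (card_le_eql XE) card_le_II.
  by exists (finmap.enum_fset X).
case: s us sA ns => // x0 s us sA ns; exists (fun i => nth x0 (x0 :: s) i) => [i j|i].
  move=> /eqP; rewrite nth_uniq ?(leq_trans (ltn_ord _)) // => /eqP; exact: val_inj.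
by apply: sA; rewrite mem_nth // (leq_trans (ltn_ord i)).
Qed.

Section Frobenius.
Variables (p : nat) (K : fieldType) (pcharK : p \in [pchar K]).
Local Notation alg := (algebraicOver (fp pcharK)).

Lemma exp_pchar_inj k : injective (fun x : K => x ^+ (p ^ k)).
Proof.
elim: k => [|k IH] x y /=; first by rewrite expn0 !expr1.
rewrite expnS !exprM => /IH; rewrite -!(pFrobenius_autE pcharK); exact: fmorph_inj.
Qed.

Lemma exp_pchar_sub1 (x : K) k : (1 - x) ^+ (p ^ k) = 1 - x ^+ (p ^ k).
Proof.
elim: k => [|k IH]; first by rewrite expn0 !expr1.
by rewrite expnSr !exprM IH -!(pFrobenius_autE pcharK) rmorphB rmorph1.
Qed.

Lemma algebraic_exp_pchar (x : K) : alg (x ^+ p) -> alg x.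
Proof.
move=> [q q_nz qx]; exists q => //; apply/rootP.
have : ev (fp pcharK) x q ^+ p = 0 by rewrite ev_frobenius; exact/rootP.
by move/eqP; rewrite expf_eq0 => /andP[_ /eqP].
Qed.

(** All [x ^ (p ^ i)] are roots of one polynomial over F_p, so two of them agree, and Frobenius is
    injective. *)
Lemma algebraic_fixed_frobenius (x : K) : alg x -> exists k, x ^+ (p ^ k.+1) = x.
Proof.
move=> [q q_nz qx]; pose Q := map_poly (fp pcharK) q.
have Q_nz : Q != 0 by rewrite map_poly_eq0.
have rt i : root Q (x ^+ (p ^ i)).
  elim: i => [|i IH]; first by rewrite expn0 expr1.
  apply/rootP; rewrite expnSr exprM -[LHS]/(ev (fp pcharK) _ q) -ev_frobenius.
  by rewrite -[ev _ _ _]/(Q.[x ^+ (p ^ i)]) (rootP IH) expr0n -leqn0 leqNgt prime_gt0 ?(pcharf_prime pcharK).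
pose s := [seq x ^+ (p ^ i) | i <- iota 0 (size Q)].
have sQ : all (root Q) s by apply/allP => _ /mapP[i _ ->].
have nus : ~~ uniq s.
  by apply/negP => /(max_poly_roots Q_nz sQ); rewrite size_map size_iota ltnn.
have /(uniqPn 0)[i [j [ij]]] := nus; rewrite size_map size_iota => js.
rewrite !(nth_map 0%N) ?size_iota ?(ltn_trans ij) // !nth_iota ?(ltn_trans ij) // !add0n => E.
exists (j - i).-1; rewrite prednK ?subn_gt0 //; apply: (@exp_pchar_inj i) => /=.
by rewrite -exprM -expnD subnK // ltnW.
Qed.

End Frobenius.

Lemma subgroup_pair (gT : groupType) (G : set gT) : subgroup G ->
  [/\ G 1%g, forall g h, G g -> G h -> G (g * h)%g & forall g, G g -> G (g^-1)%g].
Proof.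
move=> [G1 GB]; have G1' : G 1%g by move: G1; rewrite inE.
have GV g : G g -> G (g^-1)%g.
  by move=> Gg; have := GB 1%g g; rewrite !inE div1g; apply.
split=> // g h Gg Gh; have := GB g (h^-1)%g; rewrite !inE invgK; apply=> //; exact: GV.
Qed.

(** * Solutions of x + y = 1 *)

Lemma finitely_generated_mgen (K : fieldType) (G : set (mulgrp K * mulgrp K)) :
  finitely_generated G -> exists l : seq K,
    (forall a, mgen l a -> mgen l a^-1) /\
    forall g, G g -> mgen l (val g.1) /\ mgen l (val g.2).
Proof.
move=> [S /finite_seqP[s ->] ->].
pose l0 : seq K := [seq val g.1 | g <- s] ++ [seq val g.2 | g <- s].
pose l := l0 ++ [seq a^-1 | a <- l0].
have lV a : a \in l -> a^-1 \in l.
  rewrite /l !(mem_cat _ l0) [in X in X -> _]orbC => /orP[/mapP[b bl0 ->]|al0].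
    by rewrite invrK bl0.
  by rewrite (map_f _ al0) orbT.
have AV a : mgen l a -> mgen l a^-1.
  move=> [t tl ->]; exists [seq b^-1 | b <- t]; last by rewrite big_map prodfV.
  by move=> _ /mapP[b /tl bl ->]; exact: lV.
exists l; split=> // g; apply: (_ : smallest _ _ g -> _).
move=> /(_ (fun h => mgen l (val h.1) /\ mgen l (val h.2))); apply; split.
  split=> [|x y]; rewrite !inE /=; first by split; exact: mgen1.
  by move=> [x1 x2] [y1 y2]; split; apply: mgenM => //; exact: AV.
move=> h hs; split; apply: mgen_mem; rewrite !mem_cat.
  by rewrite (map_f (fun g => val g.1)).
by rewrite (map_f (fun g => val g.2)) // orbT.
Qed.

Lemma solution_nonalgebraic (K : fieldType) (p : nat) (pcharK : p \in [pchar K])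
    (G : set (mulgrp K * mulgrp K)) (u : mulgrp K * mulgrp K) :
  subgroup G -> G u -> val u.1 + val u.2 = 1 -> ~ [set (g ^+ p)%g | g in G]%classic u ->
  ~ algebraicOver (fp pcharK) (val u.1).
Proof.
move=> /subgroup_pair[G1 GM GV] Gu u1 nu /algebraic_fixed_frobenius[k xk]; apply: nu.
(* Raising this witness to the power [p] applies [k.+1] Frobenius steps to [u], which fix both [x]
   and [1 - x]. *)
exists (u ^+ (p ^ k))%g; first by elim: (p ^ k)%N => [|n IH]; rewrite ?expg0 // expgS; exact: GM.
rewrite -expgnA -expnSr -[LHS](addpair_mulrn (u : addpair K)).
have E2 : val u.2 = 1 - val u.1 by rewrite -u1 addrC addKr.
rewrite [LHS]surjective_pairing [RHS]surjective_pairing; congr (_, _); apply: val_inj.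
  by rewrite addpair_val1.
by rewrite addpair_val2 E2 exp_pchar_sub1 // xk.
Qed.

Section SolutionFamily.
Variables (K : fieldType) (p : nat) (pcharK : p \in [pchar K]).
Variables (G : set (mulgrp K * mulgrp K)) (r : nat).
Hypotheses (sG : subgroup G) (fgG : finitely_generated G) (rkG : has_rank G r).
Variables (M : nat) (u : 'I_M -> mulgrp K * mulgrp K).
Hypotheses (u_inj : injective u) (uG : forall i, G (u i))
  (u1 : forall i, val (u i).1 + val (u i).2 = 1 :> K)
  (uF : forall i, ~ [set (g ^+ p)%g | g in G]%classic (u i)).
Local Notation alg := (algebraicOver (fp pcharK)).

Lemma solution_family_card : (M <= 24 * 19 ^ r)%N.
Proof.
have [G1 GM GV] := subgroup_pair sG.
have [V [t [tG <-]]] := rkG.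
have [phi [phiD phiN phi_ker]] := rank_coordinates tG G1 GM GV fgG.
have [l [AV GA]] := finitely_generated_mgen fgG.
have nalg i : ~ alg (val (u i).1) := solution_nonalgebraic sG (uG i) (u1 i) (@uF i).
have /choice[hi hiP] i : exists h, is_height pcharK (mgen l) h /\ (0 < h (val (u i).1))%N.
  by have [h] := height_exists l (nalg i); exists h.
(* Each [hi i] is only known to be positive at its own solution; the sum is positive at all of
   them. *)
pose h x := (\sum_i hi i x)%N.
have hh : is_height pcharK (mgen l) h.
  by apply: (is_height_sum (A := fun=> mgen l)) => // i; case: (hiP i).
have A1 := mgen1 l; have AM := @mgenM _ l.
pose N (x : addpair K) := hpair h (val x.1) (val x.2).
have ND (x y : addpair K) : G x -> G y -> (N (x + y)%R <= N x + N y)%N.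
  move=> /GA[Ax1 Ax2] /GA[Ay1 Ay2].
  have e1 : (h (val (x + y)%R.1) <= h (val x.1) + h (val y.1))%N := height_mul hh Ax1 Ay1.
  have e2 : (h (val (x + y)%R.2) <= h (val x.2) + h (val y.2))%N := height_mul hh Ax2 Ay2.
  have e3 : (h (val (x + y)%R.1 / val (x + y)%R.2)%R <=
      h (val x.1 / val x.2)%R + h (val y.1 / val y.2)%R)%N.
    have -> : val (x + y).1 / val (x + y).2 = val x.1 / val x.2 * (val y.1 / val y.2).
      by rewrite mulrACA -invfM.
    by apply: (height_mul hh); apply: AM => //; exact: AV.
  by move: e1 e2 e3; rewrite /N /hpair; lia.
have NN (x : addpair K) : G x -> N (- x) = N x.
  move=> Gx; rewrite /N /hpair -[val (- x).1]/(val x.1)^-1 -[val (- x).2]/(val x.2)^-1.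
  by rewrite -invfM !(height_inv hh).
have NM (x : addpair K) n : G x -> N (x *+ n) = (n * N x)%N.
  move=> /GA[Ax1 Ax2]; rewrite /N addpair_val1 addpair_val2 /hpair -expr_div_n.
  by rewrite !(height_expE hh) // ?mulnDr //; apply: AM => //; exact: AV.
have N_ker (x : addpair K) : G x -> phi x = 0 -> N x = 0%N.
  move=> Gx /(phi_ker x Gx)[n n_gt0 xn]; have := NM x n Gx.
  rewrite xn -(mulr0n x) (NM x 0%N Gx) mul0n => /esym/eqP.
  by rewrite muln_eq0 eqn0Ngt n_gt0 /= => /eqP.
(* Unlike the family [u], this set is stable under Frobenius, as the counting argument requires. *)
pose Sol (x : addpair K) :=
  [/\ G x, val x.1 + val x.2 = 1, ~ alg (val x.1) & (0 < h (val x.1))%N].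
have p_prime := pcharf_prime pcharK.
have Sol2 x : Sol x -> val x.2 = 1 - val x.1 by case=> _ <- _ _; rewrite addrC addKr.
have Sol_eq x y : Sol x -> Sol y -> val x.1 = val y.1 -> x = y.
  move=> Sx Sy x12; rewrite [LHS]surjective_pairing [RHS]surjective_pairing.
  by congr (_, _); apply: val_inj => //=; rewrite (Sol2 x Sx) (Sol2 y Sy) x12.
have SolN3 x : Sol x -> N x = (3 * h (val x.1))%N.
  move=> Sx; rewrite /N /hpair (Sol2 x Sx) (height_ratio hh) ?(height_sub1 hh).
  - by lia.
  - by rewrite -subr_eq0 -oppr_eq0 opprB -(Sol2 x Sx) mulgrp_valP.
  - by case: Sx.
have SolG (x : addpair K) : Sol x -> G x by case.
have uS i : Sol (u i).
  split=> //; by rewrite /h (bigD1 i) //= addn_gt0; case: (hiP i) => _ ->.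
have u_frob i g : G g -> u i <> (g : addpair K) *+ p.
  by move=> Gg E; apply: (@uF i); exists g => //; rewrite E addpair_mulrn.
have card := @family_card (addpair K) G _ phi N GM GV G1 phiD phiN ND NN NM N_ker p Sol
  (prime_gt1 p_prime) SolG.
apply: (card _ _ _ _ _ M u uS) => //.
- by move=> x Sx; rewrite SolN3 //; case: Sx; lia.
- move=> x Sx; have x2 := Sol2 x Sx; case: Sx => Gx x1 nx hx; split.
  + by rewrite addpair_mulrn; elim: p => [|n IH]; rewrite ?expg0 // expgS; exact: GM.
  + by rewrite addpair_val1 addpair_val2 x2 -(expn1 p) exp_pchar_sub1 // addrC subrK.
  + by rewrite addpair_val1 => /algebraic_exp_pchar.
  + rewrite addpair_val1 (height_expE hh) ?muln_gt0 ?(prime_gt0 p_prime) ?hx //.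
    by case: (GA x Gx).
- move=> x y Sx Sy E; apply: Sol_eq => //.
  apply: (@exp_pchar_inj p K pcharK 1 (val x.1) (val y.1)).
  by rewrite /= expn1 -!addpair_val1 E.
- move=> x y Sx Sy xy _; have [Ax1 Ax2] := GA _ (SolG x Sx); have [Ay1 Ay2] := GA _ (SolG y Sy).
  rewrite SolN3 // /N.
  rewrite -[val (y - x).1]/(val y.1 / val x.1) -[val (y - x).2]/(val y.2 / val x.2).
  rewrite (Sol2 _ Sx) (Sol2 _ Sy) in Ax2 Ay2 *.
  apply: (hpair_gap hh) => //; try exact: mulgrp_valP.
  - by rewrite -(Sol2 _ Sx) mulgrp_valP.
  - by rewrite -(Sol2 _ Sy) mulgrp_valP.
  - by apply/eqP => x12; exact: xy (Sol_eq _ _ Sx Sy x12).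
- move=> x y k Sx Sy _ /andP[_ lt] k_gt0.
  have [Ax1 Ax2] := GA _ (SolG x Sx); have [Ay1 Ay2] := GA _ (SolG y Sy).
  rewrite (SolN3 y Sy) (SolN3 x Sx) in lt; rewrite (SolN3 x Sx).
  have -> (z : addpair K) : N (y - z) = hpair h (val y.1 / val z.1) (val y.2 / val z.2) by [].
  rewrite addpair_val1 addpair_val2.
  rewrite (Sol2 _ Sx) (Sol2 _ Sy) in Ax2 Ay2 *; rewrite mulnCA.
  case: Sx => _ _ nx _; case: Sy => _ _ ny _.
  by apply: (hpair_odd_power hh) => //; rewrite -(ltn_pmul2l (isT : 0 < 3)%N) mulnCA.
Qed.

End SolutionFamily.

Unset Implicit Arguments.
Set Strict Implicit.
Local Open Scope classical_set_scope.
Local Open Scope ring_scope.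

Theorem theorem2 (K : fieldType) (p : nat) (hp : p \in [pchar K])
    (G : set (mulgrp K * mulgrp K)) (r : nat)
    (hG : subgroup G) (hfg : finitely_generated G) (hr : has_rank G r) :
  ([set u : mulgrp K * mulgrp K |
      [/\ G u, val u.1 + val u.2 = 1 :> K & ~ [set (g ^+ p)%g | g in G] u]]
    #<= `I_(31 * 19 ^ r))%card.
Proof.
(* A failure of the bound yields [31 * 19 ^ r + 1] distinct solutions, against the bound
   [24 * 19 ^ r] for families. *)
apply: contrapT => /card_family[u u_inj uP].
have := @solution_family_card K p hp G r hG hfg hr _ u u_inj.
have pos : (0 < 19 ^ r)%N by rewrite expn_gt0.
suff h : forall a, (0 < a)%N -> ((31 * a).+1 <= 24 * a)%N -> False.
  by move=> card; apply: (h _ pos); apply: card => i; case: (uP i).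
by move=> a; lia.
Qed.
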